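(* Let $\Omega\subset\mathbb{R}^n$ be an open domain, $Q=L^2(\Omega;\mathbb{R}^m)$, $W=L^2(\Omega;\mathbb{R}^k)$, and let $P: Q\rightrightarrows W$ have the form $$P(q)=\{w\in L^2(\Omega;\mathbb{R}^k)\mid w(x)\in p(x,q(x)) \text{ for a.e. } x\in\Omega\},$$ where $p:\Omega\times\mathbb{R}^m\rightrightarrows\mathbb{R}^k$ is a Borel-measurable set-valued mapping with $p(x,\cdot):\mathbb{R}^m\rightrightarrows\mathbb{R}^k$ proto-differentiable for a.e. $x\in\Omega$ and having locally closed graph at $(q(x),w(x))$ for a.e. $x\in\Omega$, with $(q,w)\in\operatorname{graph}P$. Then $$\widehat D^*P(q|w)=[DP(q|w)]^{*+}=[\widetilde{DP}(q|w)]^{*+},$$ i.e., for all $\Delta q\in Q$, $\Delta w\in W$, $$\Delta q\in\widehat D^*P(q|w)(\Delta w)\iff \langle\Delta q,\Delta q'\rangle\le\langle\Delta w,\Delta w'\rangle\ \text{ whenever } \Delta w'\in DP(q|w)(\Delta q')$$ $$\iff \langle\Delta q,\Delta q'\rangle\le\langle\Delta w,\Delta w'\rangle\ \text{ whenever } \Delta w'\in \widetilde{DP}(q|w)(\Delta q').$$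
   Context: Hilbert spaces are identified with their duals. For a subset $U$ of a Hilbert space $X$ and $u\in U$: $\widehat N(u;U)=\{z\in X \mid \limsup_{U\ni u'\to u}\frac{\langle z,u'-u\rangle}{\|u'-u\|}\le 0\}$ and $T(u;U)=\{z\mid \exists\,\tau^i\searrow 0,\ u^i\in U: z=\lim_i (u^i-u)/\tau^i\}$. For a set-valued $R:Q\rightrightarrows W$ between Hilbert spaces with $\operatorname{graph}R=\{(q,w)\mid w\in R(q)\}$: - regular coderivative $\widehat D^*R(q|w)(\Delta w)=\{\Delta q\in Q\mid(\Delta q,-\Delta w)\in\widehat N((q,w);\operatorname{graph}R)\}$; - graphical derivative $DR(q|w)(\Delta q)=\{\Delta w\in W\mid(\Delta q,\Delta w)\in T((q,w);\operatorname{graph}R)\}$; - $\widetilde{DR}(q|w)$ is the set-valued mapping with $\operatorname{graph}\widetilde{DR}(q|w)=\operatorname{conv}\operatorname{graph}[DR(q|w)]$. For $J:Q\rightrightarrows W$ the upper adjoint $J^{*+}:W\rightrightarrows Q$ is $J^{*+}(\Delta w)=\{\Delta q\in Q\mid\langle\Delta q,\Delta q'\rangle\le\langle\Delta w,\Delta w'\rangle \text{ when }\Delta w'\in J(\Delta q')\}$. A set $U$ is geometrically derivable if for every $u\in U$ and $z\in T(u;U)$ there are $\varepsilon>0$ and a curve $\xi:[0,\varepsilon]\to U$ with $\xi(0)=u$ and $\lim_{t\searrow0}(\xi(t)-\xi(0))/t=z$. $R$ is proto-differentiable if $\operatorname{graph}R$ is geometrically derivable. $\operatorname{graph}R$ is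 locally closed at $(q,w)$ if there is a closed neighborhood $U\subset Q\times W$ of $(q,w)$ such that $\operatorname{graph}R\cap U$ is closed. *)

(* Defs.v *)
From HB Require Import structures.
From mathcomp Require Import all_boot all_order all_algebra.
From mathcomp Require Import all_classical all_reals all_analysis.
From mathcomp Require Import measurable_realfun.
From mathcomp Require Import ring lra.

Set Implicit Arguments.
Unset Strict Implicit.
Unset Printing Implicit Defensive.
Set Warnings "-redundant-canonical-projection".

Import Order.TTheory GRing.Theory Num.Theory.
Import numFieldNormedType.Exports.

Local Open Scope classical_set_scope.
Local Open Scope ring_scope.

(* Real inner product spaces: normed modules (hence carrying the norm topology)
   whose norm is induced by the inner product. The Hilbert spaces of interest,
   [euclid R n], [hprod V W] and [L2 mu m], are instances below. *)
HB.mixin Record NormedModule_isInnerProduct (R : realType) V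
    & NormedModule R V := {
  inner : V -> V -> R ;
  innerC : forall u v, inner u v = inner v u ;
  innerDl : forall u v w, inner (u + v) w = inner u w + inner v w ;
  innerZl : forall (a : R) u v, inner (a *: u) v = a * inner u v ;
  inner_normE : forall u, inner u u = `|u| ^+ 2
}.

#[short(type="innerProductType")]
HB.structure Definition InnerProduct (R : realType) :=
  {V of NormedModule R V & NormedModule_isInnerProduct R V}.

HB.factory Record Lmodule_isInnerProduct (R : realType) V
    & GRing.Lmodule R V := {
  ip : V -> V -> R ;
  ipC : forall u v, ip u v = ip v u ;
  ipDl : forall u v w, ip (u + v) w = ip u w + ip v w ;
  ipZl : forall (a : R) u v, ip (a *: u) v = a * ip u v ;
  ip_ge0 : forall u, 0 <= ip u u ;
  ip_eq0 : forall u, ip u u = 0 -> u = 0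
}.

HB.builders Context R V & Lmodule_isInnerProduct R V.

Let nrm (u : V) : R := Num.sqrt (ip u u).

Let ipDr u v w : ip u (v + w) = ip u v + ip u w.
Proof. by rewrite !(ipC u) ipDl. Qed.

Let ipZr a u v : ip u (a *: v) = a * ip u v.
Proof. by rewrite !(ipC u) ipZl. Qed.

Let cauchy_schwarz u v : ip u v ^+ 2 <= ip u u * ip v v.
Proof.
have [v0|v0] := eqVneq (ip v v) 0.
  rewrite (ip_eq0 v0) -(scale0r (0 : V)) !ipZr !mul0r expr0n /= mulr0.
  exact: lexx.
have vgt0 : 0 < ip v v by rewrite lt_neqAle eq_sym v0 ip_ge0.
have := ip_ge0 (ip v v *: u + (- ip u v) *: v).
rewrite !(ipDl, ipDr, ipZl, ipZr) (ipC v u) => h.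
have {h} : 0 <= ip v v * (ip u u * ip v v - ip u v ^+ 2).
  by apply: le_trans h _; rewrite le_eqVlt; apply/orP; left; apply/eqP; ring.
by rewrite pmulr_rge0// subr_ge0.
Qed.

Let nrmD u v : nrm (u + v) <= nrm u + nrm v.
Proof.
rewrite -(@ler_pXn2r _ 2)// ?nnegrE ?addr_ge0 ?sqrtr_ge0//.
rewrite sqrrD !sqr_sqrtr ?ip_ge0// ipDl !ipDr (ipC v u).
rewrite -sqrtrM ?ip_ge0//.
have : ip u v <= Num.sqrt (ip u u * ip v v).
  by rewrite (le_trans (ler_norm _))// -sqrtr_sqr ler_wsqrtr// cauchy_schwarz.
lra.
Qed.

Let nrmZ (a : R) u : nrm (a *: u) = `|a| * nrm u.
Proof.
by rewrite /nrm ipZl ipZr mulrA -expr2 sqrtrM ?sqr_ge0// sqrtr_sqr.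
Qed.

Let nrm_eq0 u : nrm u = 0 -> u = 0.
Proof.
move=> /eqP; rewrite sqrtr_eq0 => h; apply: ip_eq0.
by apply/eqP; rewrite eq_le h ip_ge0.
Qed.

HB.instance Definition _ := Lmodule_isNormed.Build R V nrmD nrmZ nrm_eq0.

Let ip_normE (u : V) : ip u u = `|u| ^+ 2.
Proof. by rewrite [RHS]sqr_sqrtr// ip_ge0. Qed.

HB.instance Definition _ :=
  NormedModule_isInnerProduct.Build R V ipC ipDl ipZl ip_normE.

HB.end.

(* R^n with its Euclidean norm. It is an alias of 'rV[R]_n because the latter
   canonically carries the sup norm. Its measurable sets are the Borel sets. *)
Definition euclid (R : realType) (n : nat) : Type := 'rV[R]_n.

Section euclid.
Context (R : realType) (n : nat).

HB.instance Definition _ := GRing.Lmodule.on (euclid R n).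

Definition euclid_dot (x y : euclid R n) : R := \sum_(i < n) x ord0 i * y ord0 i.

Let dotC x y : euclid_dot x y = euclid_dot y x.
Proof. by apply: eq_bigr => i _; rewrite mulrC. Qed.

Let dotDl x y z : euclid_dot (x + y) z = euclid_dot x z + euclid_dot y z.
Proof. by rewrite -big_split; apply: eq_bigr => i _; rewrite mxE mulrDl. Qed.

Let dotZl a x y : euclid_dot (a *: x) y = a * euclid_dot x y.
Proof. by rewrite mulr_sumr; apply: eq_bigr => i _; rewrite mxE mulrA. Qed.

Let dot_ge0 x : 0 <= euclid_dot x x.
Proof. by apply: sumr_ge0 => i _; rewrite -expr2 sqr_ge0. Qed.

Let dot_eq0 x : euclid_dot x x = 0 -> x = 0.
Proof.
move=> /eqP; rewrite psumr_eq0; last by move=> i _; rewrite -expr2 sqr_ge0.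
move=> /allP x0; apply/rowP => i; rewrite mxE.
by have := x0 i (mem_index_enum _); rewrite /= mulf_eq0 orbb => /eqP.
Qed.

HB.instance Definition _ := Lmodule_isInnerProduct.Build R (euclid R n)
  dotC dotDl dotZl dot_ge0 dot_eq0.

HB.instance Definition _ := Measurable.copy (euclid R n)
  (g_sigma_algebraType (@open (euclid R n))).

End euclid.

(* The Hilbert product, with norm sqrt (|v|^2 + |w|^2); it is an alias of V * W
   because the latter canonically carries the max norm. *)
Definition hprod (V W : Type) : Type := (V * W)%type.

Section hprod.
Context (R : realType) (V W : innerProductType R).

HB.instance Definition _ := GRing.Lmodule.on (hprod V W).

Definition hprod_inner (x y : hprod V W) : R := inner x.1 y.1 + inner x.2 y.2.

Let ip2C x y : hprod_inner x y = hprod_inner y x.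
Proof. by rewrite /hprod_inner innerC [X in _ + X]innerC. Qed.

Let ip2Dl x y z : hprod_inner (x + y) z = hprod_inner x z + hprod_inner y z.
Proof. by rewrite /hprod_inner !innerDl addrACA. Qed.

Let ip2Zl a x y : hprod_inner (a *: x) y = a * hprod_inner x y.
Proof. by rewrite /hprod_inner !innerZl mulrDr. Qed.

Let ip2_ge0 x : 0 <= hprod_inner x x.
Proof. by rewrite /hprod_inner !inner_normE addr_ge0 ?sqr_ge0. Qed.

Let ip2_eq0 x : hprod_inner x x = 0 -> x = 0.
Proof.
rewrite /hprod_inner !inner_normE => /eqP; rewrite paddr_eq0 ?sqr_ge0// !sqrf_eq0 !normr_eq0.
by case: x => a b /= /andP[/eqP -> /eqP ->].
Qed.

HB.instance Definition _ := Lmodule_isInnerProduct.Build R (hprod V W)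
  ip2C ip2Dl ip2Zl ip2_ge0 ip2_eq0.

End hprod.

Section pushforward_sigma_finite.
Context d1 d2 (T1 : measurableType d1) (T2 : measurableType d2) (R : realType).
Variables (mu : {measure set T1 -> \bar R}).
Variables (f : T1 -> T2) (g : T2 -> T1).
Hypothesis (mu_sf : sigma_finite setT mu).
Hypotheses (mf : measurable_fun setT f) (mg : measurable_fun setT g).
Hypothesis (fK : cancel f g).

Let nu : set T2 -> \bar R := pushforward mu f.

Let nu0 : nu set0 = 0%E.
Proof. by rewrite /nu /pushforward preimage_set0 measure0. Qed.

Let nu_ge0 A : (0 <= nu A)%E.
Proof. exact: measure_ge0. Qed.

Let nu_sigma_additive : semi_sigma_additive nu.
Proof. exact: (@measure_semi_sigma_additive _ _ _ (pushforward mu f)). Qed.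

HB.instance Definition _ := isMeasure.Build d2 T2 R nu
  nu0 nu_ge0 nu_sigma_additive.

Let nu_sigma_finite : sigma_finite setT nu.
Proof.
have [F FT Ffin] := mu_sf.
exists (fun k => g @^-1` F k).
  by rewrite -preimage_bigcup -FT preimage_setT.
move=> k; have [mF muF] := Ffin k; split.
  by rewrite -[X in measurable X]setTI; exact: mg.
rewrite /nu /pushforward (_ : f @^-1` _ = F k)//.
by apply/seteqP; split => x /=; rewrite fK.
Qed.

HB.instance Definition _ := Measure_isSigmaFinite.Build d2 T2 R nu
  nu_sigma_finite.

Definition iso_pushforward : {sigma_finite_measure set T2 -> \bar R} := nu.

End pushforward_sigma_finite.

Lemma sigma_finite_prod d1 d2 (T1 : measurableType d1)
    (T2 : measurableType d2) (R : realType)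
    (m1 : {sigma_finite_measure set T1 -> \bar R})
    (m2 : {sigma_finite_measure set T2 -> \bar R}) :
  sigma_finite setT (m1 \x m2)%E.
Proof.
have /sigma_finiteP[F [TF ndF Foo]] := sigma_finiteT m1.
have /sigma_finiteP[G [TG ndG Goo]] := sigma_finiteT m2.
exists (fun n => F n `*` G n).
  rewrite -setXTT TF TG predeqE => -[x y]; split.
    move=> [/= [n _ Fnx] [k _ Gky]]; exists (maxn n k) => //; split.
    - by move: x Fnx; exact/subsetPset/ndF/leq_maxl.
    - by move: y Gky; exact/subsetPset/ndG/leq_maxr.
  by move=> [n _ []/= ? ?]; split; exists n.
move=> k; have [? ?] := Foo k; have [? ?] := Goo k.
split; first exact: measurableX.
by rewrite product_measure1E// lte_mul_pinfty// ge0_fin_numE.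
Qed.

Section lebesgue_tuple.
Context (R : realType).
Local Notation RT := (measurableTypeR R).

Let tcons n (x : RT * n.-tuple RT) : n.+1.-tuple RT := [tuple of x.1 :: x.2].

Let tuncons n (t : n.+1.-tuple RT) : RT * n.-tuple RT :=
  (tnth t ord0, [tuple of behead t]).

Let measurable_tcons n : measurable_fun setT (@tcons n).
Proof. exact: measurable_cons. Qed.

Let measurable_tuncons n : measurable_fun setT (@tuncons n).
Proof.
apply: measurable_fun_pair.
- exact: measurable_tnth.
- exact: measurable_behead.
Qed.

Let tconsK n : cancel (@tcons n) (@tuncons n).
Proof. by move=> [a t]; congr (_, _); apply: val_inj. Qed.

(* n-fold product of the Lebesgue measure of R, see [lebesgue_tuple_box] *)
Fixpoint lebesgue_tuple n : {sigma_finite_measure set (n.-tuple RT) -> \bar R} :=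
  if n is n'.+1 then
    iso_pushforward (sigma_finite_prod (@lebesgue_measure R) (lebesgue_tuple n'))
      (@measurable_tcons n') (@measurable_tuncons n') (@tconsK n')
  else dirac ([tuple] : 0.-tuple RT).

End lebesgue_tuple.

Lemma contractive_continuous (R : realType) (V : normedModType R) (p : V -> R) :
  (forall x y, `|p x - p y| <= `|x - y|) -> continuous p.
Proof.
move=> pl x; apply/cvgrPdist_lt => e e0; near=> y.
apply: le_lt_trans (pl x y) _.
by near: y; apply: cvgr_dist_lt e0; exact: cvg_id.
Unshelve. all: by end_near. Qed.

Section lebesgue_euclid.
Context (R : realType) (n : nat).
Local Notation RT := (measurableTypeR R).

Let vec (t : n.-tuple RT) : euclid R n := \row_i tnth t i.

Let unvec (x : euclid R n) : n.-tuple RT := [tuple x ord0 i | i < n].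

Let vecK : cancel vec unvec.
Proof. by move=> t; apply: eq_from_tnth => i; rewrite tnth_mktuple mxE. Qed.

Let euclid_normE (x : euclid R n) : `|x| ^+ 2 = \sum_i x ord0 i ^+ 2.
Proof. by rewrite -inner_normE; apply: eq_bigr => i _; rewrite expr2. Qed.

Lemma euclid_coord_le_norm (x : euclid R n) i : `|x ord0 i| <= `|x|.
Proof.
rewrite -(@ler_pXn2r _ 2) ?nnegrE// euclid_normE real_normK ?num_real//.
by rewrite (bigD1 i)//= lerDl sumr_ge0// => j _; rewrite sqr_ge0.
Qed.

Lemma euclid_norm_le_coord (x : euclid R n) (e : R) : 0 <= e ->
  (forall i, `|x ord0 i| <= e) -> `|x| <= n%:R * e.
Proof.
move=> e0 xe; rewrite -(@ler_pXn2r _ 2) ?nnegrE ?mulr_ge0// euclid_normE.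
apply: (@le_trans _ _ (\sum_(i < n) e ^+ 2)).
  apply: ler_sum => i _; rewrite -[leLHS]real_normK ?num_real//.
  by rewrite ler_pXn2r ?nnegrE.
rewrite sumr_const card_ord exprMn -[leLHS]mulr_natl ler_wpM2r ?sqr_ge0//.
by rewrite -natrX ler_nat; case: (n) => // k; rewrite leq_pmulr.
Qed.

Let box (q : n.-tuple rat) (k : nat) : set (n.-tuple RT) :=
  [set t | forall i, `|ratr (tnth q i) - tnth t i| < k.+1%:R^-1].

Let measurable_box q k : measurable (box q k).
Proof.
have -> : box q k = \bigcap_(i in [set: 'I_n])
    ((fun t => tnth t i) @^-1`
      `](ratr (tnth q i) - k.+1%:R^-1 : R), (ratr (tnth q i) + k.+1%:R^-1)[%classic).
  apply/seteqP; split => t /= h.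
    by move=> i _; rewrite /= in_itv/= -ltr_distlC.
  by move=> i; have := h i I; rewrite /= in_itv/= -ltr_distlC.
apply: fin_bigcap_measurable; first exact: finite_finset.
move=> i _; rewrite -[X in measurable X]setTI.
by apply: measurable_tnth => //; exact: measurable_itv.
Qed.

Let measurable_vec : measurable_fun setT vec.
Proof.
apply: (@measurability _ _ _ _ _ _ (@open (euclid R n))) => // _ [U oU <-].
rewrite setTI.
pose F (m : nat) : set (n.-tuple RT) :=
  if unpickle m is Some (q, k) then
    if `[< box q k `<=` vec @^-1` U >] then box q k else set0
  else set0.
rewrite (_ : _ @^-1` _ = \bigcup_m F m); last first.
  apply/seteqP; split => [t /= Ut|t [m _]]; last first.
    rewrite /F; case: unpickle => [[q k]|//].
    by case: asboolP => // + ?; exact.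
  have [e /= e0 eU] : exists2 e : R, 0 < e & ball (vec t) e `<=` U.
    by move: oU; rewrite openE => /(_ _ Ut) /nbhs_ballP.
  have [k kP] : exists k : nat, n%:R * (2 / k.+1%:R) < e.
    have : \forall k \near \oo, k.+1%:R^-1 < e / (n.+1%:R * 2).
      have h : 0 < e / (n.+1%:R * 2) by rewrite divr_gt0.
      exact: (near_infty_natSinv_lt (PosNum h)).
    move=> [k _ /(_ k (leqnn _)) /= kP]; exists k.
    move: kP; rewrite ltr_pdivlMr// => kP.
    apply: le_lt_trans kP; rewrite mulrA mulrC.
    rewrite ler_wpM2l ?invr_ge0// ler_wpM2r// ler_nat.
    exact: leqnSn.
  have /choice[q qP] : forall i : 'I_n, exists r : rat,
      `|ratr r - tnth t i| < k.+1%:R^-1.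
    move=> i; have [r] := @rat_in_itvoo R (tnth t i - k.+1%:R^-1)
      (tnth t i + k.+1%:R^-1) ltac:(by rewrite ltrD2l gtrN).
    by rewrite in_itv/= -ltr_distl => h; exists r.
  exists (pickle ([tuple q i | i < n], k)) => //.
  rewrite /F pickleK; case: asboolP => [_|].
    by move=> i; rewrite tnth_mktuple.
  case=> s /= sbox; apply: eU; rewrite -ball_normE /=.
  apply: le_lt_trans kP; apply: euclid_norm_le_coord; first by rewrite divr_ge0.
  move=> i; rewrite !mxE (_ : _ - _ = (tnth t i - ratr (q i)) + (ratr (q i) - tnth s i)); last by ring.
  rewrite (le_trans (ler_normD _ _))// mulrDl lerD//.
  - by rewrite distrC mul1r ltW.
  - by have := sbox i; rewrite tnth_mktuple mul1r => /ltW.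
apply: bigcupT_measurable => m; rewrite /F.
by case: unpickle => [[q k]|//]; case: ifP.
Qed.

Let measurable_unvec : measurable_fun setT unvec.
Proof.
apply/measurable_fun_tnthP => i.
pose p (x : euclid R n) : R := x ord0 i.
have pc : continuous p.
  apply: contractive_continuous => x y.
  by have := euclid_coord_le_norm (x - y) i; rewrite !mxE.
have mp : measurable_fun [set: euclid R n] (p : euclid R n -> RT).
  apply: (measurability _ (RGenOpens.measurableE R)).
  move=> _ [_ [a [b ->]] <-]; rewrite setTI; apply: sub_sigma_algebra.
  by apply: open_comp => //; exact: itv_open.
apply: eq_measurable_fun mp => x _.
by rewrite /= tnth_mktuple.
Qed.

(* image of the product measure under n.-tuple R ~ R^n, see
   [lebesgue_euclid_box] *)
Definition lebesgue_euclid : {sigma_finite_measure set (euclid R n) -> \bar R} :=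
  iso_pushforward (sigma_finiteT (lebesgue_tuple R n))
    measurable_vec measurable_unvec vecK.

Lemma open_measurable_euclid (U : set (euclid R n)) : open U -> measurable U.
Proof. exact: sub_sigma_algebra. Qed.

End lebesgue_euclid.

Definition lebesgue_on (R : realType) (n : nat) (Omega : set (euclid R n))
    (oOmega : open Omega) : {measure set (euclid R n) -> \bar R} :=
  mrestr (lebesgue_euclid R n) (open_measurable_euclid oOmega).

Lemma lebesgue_tuple_box (R : realType) n (A : 'I_n -> set (measurableTypeR R)) :
  (forall i, measurable (A i)) ->
  lebesgue_tuple R n [set t | forall i, A i (tnth t i)] =
  (\big[*%E/1%E]_(i < n) lebesgue_measure (A i))%E.
Proof.
elim: n A => [|n IHn] A mA.
  rewrite big_ord0 /= /dirac indicE mem_set//.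
  by move=> [].
rewrite big_ord_recl -(IHn (fun i => A (lift ord0 i)))//.
rewrite [LHS]/= /iso_pushforward /pushforward /=.
rewrite -product_measure1E//.
- congr (product_measure1 _ _ _); apply/seteqP; split => -[a t] /=.
    move=> h; split; first exact: (h ord0).
    by move=> i; have := h (lift ord0 i); rewrite tnthS.
  move=> [Aa At] i; have [j ->|->//] := unliftP ord0 i.
  by rewrite tnthS.
- rewrite (_ : [set _ | _] = \bigcap_(i in [set: 'I_n])
      ((fun t => tnth t i) @^-1` A (lift ord0 i))); last first.
    by apply/seteqP; split => t /= h; [move=> i _|move=> i]; exact: h.
  apply: fin_bigcap_measurable; first exact: finite_finset.
  by move=> i _; rewrite -[X in measurable X]setTI; exact: measurable_tnth.
Qed.

Lemma lebesgue_euclid_box (R : realType) n (A : 'I_n -> set (measurableTypeR R)) :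
  (forall i, measurable (A i)) ->
  lebesgue_euclid R n [set x | forall i, A i (x ord0 i)] =
  (\big[*%E/1%E]_(i < n) lebesgue_measure (A i))%E.
Proof.
move=> mA; rewrite -lebesgue_tuple_box//.
rewrite [LHS]/= /iso_pushforward /pushforward /=.
congr (lebesgue_tuple _ _ _); apply/seteqP.
by split => t /= h i; have := h i; rewrite mxE.
Qed.

(* L^2(mu; R^m): square-integrable functions T -> R^m (that is, with all
   components in the scalar L^2), modulo equality mu-almost everywhere. *)
Section L2.
Context d (T : measurableType d) (R : realType).
Variables (mu : {measure set T -> \bar R}) (m : nat).

Definition L2fun : {pred T -> euclid R m} :=
  [pred f : T -> euclid R m | [forall i, (fun x => f x ord0 i) \in Lfun mu 2%:E]].

Let L2fun_submod_closed : submod_closed L2fun.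
Proof.
have S := @Lfun_submod_closed _ T R mu 2%:E (lee1n 2).
split.
  apply/forallP => i; rewrite (_ : (fun _ => _) = (0 : T -> R)); first by case: S.
  by apply/funext => x; rewrite mxE.
move=> a f g /forallP fL /forallP gL; apply/forallP => i.
rewrite (_ : (fun _ => _) =
  a *: (fun x => f x ord0 i : R) + (fun x => g x ord0 i)).
  by case: S => _ S; exact: (S a _ _ (fL i) (gL i)).
by apply/funext => x; rewrite !mxE.
Qed.

HB.instance Definition _ := GRing.isSubmodClosed.Build R (T -> euclid R m)
  L2fun L2fun_submod_closed.

Definition L2fun_type : Type := {f : T -> euclid R m | f \in L2fun}.
HB.instance Definition _ := SubChoice.on L2fun_type.
HB.instance Definition _ := [SubChoice_isSubLmodule of L2fun_type by <:].

Definition L2null : {pred L2fun_type} :=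
  [pred f | `[< \forall x \ae mu, val f x = 0 >]].

Let L2null_zmod_closed : zmod_closed L2null.
Proof.
split; first by apply/asboolP; apply: aeW.
move=> f g /asboolP f0 /asboolP g0; apply/asboolP.
apply: filterS2 f0 g0 => x fx gx.
by rewrite (_ : val (f - g) x = val f x - val g x)// fx gx subr0.
Qed.

HB.instance Definition _ := GRing.isZmodClosed.Build L2fun_type L2null
  L2null_zmod_closed.

Definition L2 : Type := Quotient.quot L2null.
HB.instance Definition _ := GRing.Zmodule.on L2.

Definition L2_class (f : L2fun_type) : L2 := \pi_(Quotient.quot L2null)%qT f.

Definition L2_repr (u : L2) : L2fun_type := repr (u : Quotient.quot L2null).

(* an arbitrary representative of the class u *)
Definition L2_fun (u : L2) : T -> euclid R m := val (L2_repr u).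

Coercion L2_fun : L2 >-> Funclass.

Lemma L2_class_ae (f : L2fun_type) :
  \forall x \ae mu, L2_fun (L2_class f) x = val f x.
Proof.
have : (f == L2_repr (L2_class f) %[mod Quotient.quot L2null])%qT.
  by rewrite reprK.
rewrite -Quotient.idealrBE => /asboolP; apply: filterS => x /eqP.
rewrite (_ : val _ x = val f x - L2_fun (L2_class f) x)// subr_eq0.
by move=> /eqP.
Qed.

Lemma L2_eqP (u v : L2) :
  (\forall x \ae mu, L2_fun u x = L2_fun v x) -> u = v.
Proof.
move=> uv.
rewrite -[u](@reprK _ (Quotient.quot L2null)).
rewrite -[v](@reprK _ (Quotient.quot L2null)).
apply/eqP; rewrite -Quotient.idealrBE; apply/asboolP.
apply: filterS uv => x uvx.
by rewrite (_ : val _ x = L2_fun u x - L2_fun v x)// uvx subrr.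
Qed.

Lemma L2_funD (u v : L2) :
  \forall x \ae mu, L2_fun (u + v) x = L2_fun u x + L2_fun v x.
Proof.
have <- : L2_class (L2_repr u + L2_repr v) = u + v.
  by rewrite /L2_class Quotient.pi_add !reprK.
by apply: filterS (L2_class_ae (L2_repr u + L2_repr v)) => x ->.
Qed.

Let scale (a : R) (u : L2) : L2 := L2_class (a *: L2_repr u).

Let scale_ae a u :  \forall x \ae mu, L2_fun (scale a u) x = a *: L2_fun u x.
Proof. by apply: filterS (L2_class_ae (a *: L2_repr u)) => x ->. Qed.

Let scaleA a b u : scale a (scale b u) = scale (a * b) u.
Proof.
apply: L2_eqP; near=> x.
rewrite (near (scale_ae a (scale b u)) x)// (near (scale_ae b u) x)//.
by rewrite (near (scale_ae (a * b) u) x)// scalerA.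
Unshelve. all: by end_near. Qed.

Let scale1 : left_id 1 scale.
Proof.
by move=> u; apply: L2_eqP; apply: filterS (scale_ae 1 u) => x ->; rewrite scale1r.
Qed.

Let scaleDr : right_distributive scale +%R.
Proof.
move=> a u v; apply: L2_eqP; near=> x.
rewrite (near (scale_ae a (u + v)) x)// (near (L2_funD u v) x)// scalerDr.
rewrite (near (L2_funD (scale a u) (scale a v)) x)//.
by rewrite (near (scale_ae a u) x)// (near (scale_ae a v) x).
Unshelve. all: by end_near. Qed.

Let scaleDl u : {morph scale^~ u : a b / a + b}.
Proof.
move=> a b; apply: L2_eqP; near=> x.
rewrite (near (scale_ae (a + b) u) x)// scalerDl.
rewrite (near (L2_funD (scale a u) (scale b u)) x)//.
by rewrite (near (scale_ae a u) x)// (near (scale_ae b u) x).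
Unshelve. all: by end_near. Qed.

HB.instance Definition _ := GRing.Zmodule_isLmodule.Build R L2
  scaleA scale1 scaleDr scaleDl.

Lemma L2_funZ a (u : L2) : \forall x \ae mu, L2_fun (a *: u) x = a *: L2_fun u x.
Proof. exact: scale_ae. Qed.

Lemma L2_fun_Lfun (u : L2) i : (fun x => L2_fun u x ord0 i) \in Lfun mu 2%:E.
Proof.
have := valP (L2_repr u).
by move/forallP => /(_ i).
Qed.

Let integrable_inner (u v : L2) :
  mu.-integrable setT (EFin \o (fun x => inner (L2_fun u x) (L2_fun v x))).
Proof.
rewrite (_ : _ \o _ = fun x =>
    (\sum_(i < m) (L2_fun u x ord0 i * L2_fun v x ord0 i)%:E)%E); last first.
  by apply/funext => x /=; rewrite sumEFin.
apply: integrable_sum => // i _; apply/Lfun1_integrable.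
exact: Lfun2_mul_Lfun1 (L2_fun_Lfun u i) (L2_fun_Lfun v i).
Qed.

Definition L2_inner (u v : L2) : R :=
  Rintegral mu setT (fun x => inner (L2_fun u x) (L2_fun v x)).

Let L2_innerC u v : L2_inner u v = L2_inner v u.
Proof. by apply: eq_Rintegral => x _; rewrite innerC. Qed.

Let ae_eq_L2_inner (f g : T -> R) : measurable_fun setT f ->
  measurable_fun setT g -> (\forall x \ae mu, f x = g x) ->
  Rintegral mu setT f = Rintegral mu setT g.
Proof.
move=> mf mg fg; congr fine; apply: ae_eq_integral => //.
- exact/measurable_EFinP.
- exact/measurable_EFinP.
- by apply: filterS fg => x /= ->.
Qed.

Let measurable_inner u v :
  measurable_fun setT (fun x => inner (L2_fun u x) (L2_fun v x)).
Proof. by apply/measurable_EFinP; exact: measurable_int (integrable_inner u v). Qed.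

Let L2_innerDl u v w : L2_inner (u + v) w = L2_inner u w + L2_inner v w.
Proof.
rewrite /L2_inner -RintegralD//.
apply: ae_eq_L2_inner => //; first exact: measurable_funD.
by apply: filterS (L2_funD u v) => x ->; rewrite innerDl.
Qed.

Let L2_innerZl a u v : L2_inner (a *: u) v = a * L2_inner u v.
Proof.
rewrite /L2_inner -RintegralZl//.
apply: ae_eq_L2_inner => //; first exact: measurable_funM.
by apply: filterS (L2_funZ a u) => x ->; rewrite innerZl.
Qed.

Let L2_inner_ge0 u : 0 <= L2_inner u u.
Proof. by apply: Rintegral_ge0 => x _; rewrite inner_normE sqr_ge0. Qed.

Let L2_inner_eq0 u : L2_inner u u = 0 -> u = 0.
Proof.
move=> u0.
pose f (x : T) : \bar R := (inner (L2_fun u x) (L2_fun u x))%:E.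
have f0 x : (0 <= f x)%E by rewrite lee_fin inner_normE sqr_ge0.
have fI : (\int[mu]_x `|f x| = 0)%E.
  under eq_integral => x _ do rewrite gee0_abs//.
  have If : (\int[mu]_x f x)%E \is a fin_num.
    exact: integrable_fin_num (integrable_inner u u).
  by rewrite -(fineK If); congr EFin; exact: u0.
have := (ae_eq_integral_abs mu measurableT
  (measurable_int mu (integrable_inner u u))).1 fI.
move=> H; rewrite -(scale0r u); apply: L2_eqP; near=> x.
rewrite (near (L2_funZ 0 u) x)// scale0r.
have /(_ I) : setT x -> f x = 0%E by near: x; exact: H.
move=> [] /eqP; rewrite inner_normE sqrf_eq0 normr_eq0 => /eqP.
by [].
Unshelve. all: by end_near. Qed.

HB.instance Definition _ := Lmodule_isInnerProduct.Build R L2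
  L2_innerC L2_innerDl L2_innerZl L2_inner_ge0 L2_inner_eq0.

End L2.

Section cones.
Context (R : realType) (V : innerProductType R).
Implicit Types (U : set V) (u z : V).

(* u' ranges over U minus u; if u is isolated in U the limsup is -oo *)
Definition regular_normal_cone U u : set V :=
  [set z | (limf_esup (fun u' => (inner z (u' - u) / `|u' - u|)%:E)
              (within U u^') <= 0)%E].

Definition tangent_cone U u : set V :=
  [set z | exists (tau : nat -> R) (v : nat -> V),
     [/\ forall i, 0 < tau i, tau i @[i --> \oo] --> 0,
         forall i, U (v i) &
         (tau i)^-1 *: (v i - u) @[i --> \oo] --> z]].

Definition geometrically_derivable U : Prop :=
  forall u z, U u -> tangent_cone U u z ->
  exists (e : R) (xi : R -> V),
    [/\ 0 < e, forall t, 0 <= t <= e -> U (xi t), xi 0 = u &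
        t^-1 *: (xi t - xi 0) @[t --> 0^'+] --> z].

Definition convex_hull U : set V := smallest (@convex_set R V) U.

End cones.

Section set_valued.
Context (R : realType) (Q W : innerProductType R).
Implicit Types (F : Q -> set W) (q : Q) (w : W).

Definition graph F : set (hprod Q W) := [set z | F z.1 z.2].

Definition regular_coderivative F q w : W -> set Q := fun dw =>
  [set dq | regular_normal_cone (graph F) (q, w) (dq, - dw)].

Definition graphical_derivative F q w : Q -> set W := fun dq =>
  [set dw | tangent_cone (graph F) (q, w) (dq, dw)].

Definition convexified_derivative F q w : Q -> set W := fun dq =>
  [set dw | convex_hull (graph (graphical_derivative F q w)) (dq, dw)].

Definition upper_adjoint (J : Q -> set W) : W -> set Q := fun dw =>
  [set dq | forall dq' dw', J dq' dw' -> inner dq dq' <= inner dw dw'].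

Definition proto_differentiable F : Prop := geometrically_derivable (graph F).

Definition locally_closed_graph F q w : Prop :=
  exists N : set (hprod Q W),
    [/\ nbhs ((q, w) : hprod Q W) N, closed N & closed (graph F `&` N)].

End set_valued.

(* p is a set-valued map on Omega x R^m (its values for x outside Omega are
   irrelevant), required to have a Borel graph. For closed-valued maps this
   follows from the inverse images of open sets being Borel; in the absence of
   closed values the inverse-image condition only constrains the closures of the
   values. *)
Definition borel_measurable_map (R : realType) (n m k : nat)
    (Omega : set (euclid R n)) (p : euclid R n -> euclid R m -> set (euclid R k)) :=
  <<s @open (euclid R n * euclid R m * euclid R k)%type >>
    [set z | Omega z.1.1 /\ p z.1.1 z.1.2 z.2].

Definition pointwise_map d (T : measurableType d) (R : realType)
    (mu : {measure set T -> \bar R}) (m k : nat)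
    (p : T -> euclid R m -> set (euclid R k)) : L2 mu m -> set (L2 mu k) :=
  fun q => [set w : L2 mu k | {ae mu, forall x, p x (q x) (w x)}].

Arguments pointwise_map {d T R} mu {m k} p.

(* Main.v *)
Require Import Defs.
From HB Require Import structures.
From mathcomp Require Import all_boot all_order all_algebra.
From mathcomp Require Import all_classical all_reals all_analysis.
From mathcomp Require Import measurable_realfun.
From mathcomp Require Import ring lra.

Set Implicit Arguments.
Unset Strict Implicit.
Unset Printing Implicit Defensive.

Import Order.TTheory GRing.Theory Num.Theory.
Import numFieldNormedType.Exports.

Local Open Scope classical_set_scope.
Local Open Scope ring_scope.

(* The inclusion of the regular normal cone in the polar of the tangent cone
   holds in every Hilbert space. For the converse, let [z] be polar to the
   tangent cone of the graph of [P] at [u = (q, w)]. If, for [x] in a non-null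
   set, some tangent vector of the graph of [p x] at [u x] had a positive inner
   product with [z x], then by geometric derivability it would be realized along
   the fixed steps [1 / (i + 1)]; choosing these data measurably on a set of
   positive finite measure, with uniform bounds, would produce by dominated
   convergence an L^2 tangent vector violating polarity. So [z x] is polar to
   the finite-dimensional tangent cone, hence regular normal by compactness of the
   unit ball, for almost every [x]. Finally pointwise regular normality gives
   regular normality in L^2: if [v_j -> u] fast and
   [inner z (v_j - u) > e |v_j - u|], then almost every [x] eventually leaves
   [A_j = { inner (z x) (h_j x) > eta |z x| |h_j x| }], [h_j = v_j - u], so the
   integral of [|z|^2] over [A_j] tends to 0, and Cauchy-Schwarz gives a
   contradiction.
   Measurable choice uses no topology on the base space: a measurable set of
   [T * (nat -> nat)] is the projection of a countable intersection of sets
   depending on finitely many entries, and a branch of the resulting tree is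
   followed inside measurable hulls. *)

(** * Measurable selection *)

(** Measurable supersets of [E] with measures tending to the infimum [c] intersect in a set [H] of
    measure [c]. For any other measurable superset [M], the part of [H] inside [M] still has measure
    at least [c], so the rest is null; finiteness of [mu F] permits the subtraction. *)
Lemma measurable_hull d (T : measurableType d) (R : realType)
    (mu : {measure set T -> \bar R}) (F E : set T) :
  measurable F -> (mu F < +oo)%E -> E `<=` F ->
  exists H, [/\ measurable H, E `<=` H &
    forall M, measurable M -> E `<=` M -> mu (H `\` M) = 0%E].
Proof.
move=> mF Foo EF.
pose c := ereal_inf [set mu M | M in [set M | measurable M /\ E `<=` M]].
have cF : (c <= mu F)%E by apply: ereal_inf_lbound; exists F.
have c0 : (0 <= c)%E.
  by apply: le_ereal_inf_tmp => _ [M _ <-]; exact: measure_ge0.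
have cfin : c \is a fin_num by rewrite ge0_fin_numE// (le_lt_trans cF).
have /choice[M HM] : forall i : nat, exists M,
    [/\ measurable M, E `<=` M & (mu M < c + i.+1%:R^-1%:E)%E].
  move=> i.
  have [_ [M [mM EM] <-] Mi] := lb_ereal_inf_adherent (ltac:(by [])
    : 0 < i.+1%:R^-1 :> R) cfin.
  by exists M.
have mM i : measurable (M i) by case: (HM i).
pose H := \bigcap_i M i.
have mH : measurable H by exact: bigcapT_measurable.
have EH : E `<=` H by move=> x Ex i _; case: (HM i) => _ + _; exact.
have muH : (mu H <= c)%E.
  apply/lee_addgt0Pr => e e0.
  have [i ie] : exists i : nat, i.+1%:R^-1 < e.
    have [i _ /(_ i (leqnn _))] := near_infty_natSinv_lt (PosNum e0).
    by exists i.
  have [_ _ /ltW Mi] := HM i; apply: (@le_trans _ _ (mu (M i))).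
    by apply: le_measure; rewrite ?inE//; exact: bigcap_inf.
  by apply: (le_trans Mi); rewrite leeD2l// lee_fin ltW.
exists H; split => // M' mM' EM'.
have muI : (c <= mu (H `&` M'))%E.
  apply: ereal_inf_lbound; exists (H `&` M') => //; split.
    exact: measurableI.
  by rewrite subsetI.
have Hoo : (mu H < +oo)%E by rewrite (le_lt_trans muH)// ltey_eq cfin.
rewrite measureD//; apply/eqP; rewrite eq_le; apply/andP; split; last first.
  rewrite sube_ge0 ?ge0_fin_numE ?(le_lt_trans _ Hoo)//;
    by apply: le_measure; rewrite ?inE//; exact: measurableI.
by rewrite leeBlDr ?add0e ?ge0_fin_numE ?(le_lt_trans _ Hoo)//
  ?(le_trans muH)//; apply: le_measure; rewrite ?inE//; exact: measurableI.
Qed.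

Definition agree (k : nat) (r s : nat -> nat) :=
  forall i, (i < k)%N -> r i = s i.

(* The leftmost branch of a tree of measurable hulls: almost everywhere on the
   hull of a node the point lies in the hull of one of its children. *)
Lemma scheme_selection d (T : measurableType d) (R : realType)
    (mu : {measure set T -> \bar R}) (F : set T)
    (A : nat -> (nat -> nat) -> set T) :
  measurable F -> (mu F < +oo)%E ->
  (forall k r, measurable (A k r)) ->
  (forall k r s, agree k r s -> A k r = A k s) ->
  ~ mu.-negligible [set x | F x /\ exists r, forall k, A k r x] ->
  exists (B : set T) (r : T -> nat -> nat),
    [/\ measurable B, B `<=` F, (0 < mu B)%E,
        forall k, measurable_fun setT (fun x => r x k) &
        forall x, B x -> forall k, A k (r x) x].
Proof.
move=> mF Foo mA Aloc.
(* [E t] collects the points with a branch through the node [t]. It need not be measurable, so hulls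
   replace it below. *)
pose E (t : seq nat) := [set x | F x /\ exists2 r,
  agree (size t) r (nth 0%N t) & forall k, A k r x].
rewrite (_ : [set x | _] = E [::]); last first.
  apply/seteqP; split => x [Fx].
    by move=> [r Ar]; split => //; exists r.
  by move=> [r _ Ar]; split => //; exists r.
move=> E0.
have /choice[H0 H0P] : forall t, exists H, [/\ measurable H, E t `<=` H &
    forall M, measurable M -> E t `<=` M -> mu (H `\` M) = 0%E].
  by move=> t; apply: (measurable_hull mF Foo) => x [].
(* The cut by [A] makes the condition of level [size t] hold on the whole hull, also at points
   outside [E t]. *)
pose H t := H0 t `&` F `&` A (size t) (nth 0%N t).
have mH t : measurable (H t).
  by apply: measurableI => //; apply: measurableI => //; case: (H0P t).
have EH t : E t `<=` H t.
  move=> x Ex; have [_ /(_ _ Ex) H0x _] := H0P t.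
  case: Ex => Fx [r rt Ar]; split => //.
  by rewrite -(Aloc _ _ _ rt).
have Hull t M : measurable M -> E t `<=` M -> mu (H t `\` M) = 0%E.
  move=> mM EM; have [mH0 _ /(_ M mM EM) h] := H0P t.
  apply/eqP; rewrite -measure_le0 -h; apply: le_measure; rewrite ?inE//.
  - exact: measurableD.
  - exact: measurableD.
  - by apply: setSD => x [[]].
have [node nodeP] : exists node : nat -> seq nat,
    forall t, exists j, node j = t.
  exists (fun j => odflt [::] (unpickle j)) => t; exists (pickle t).
  by rewrite pickleK.
(* [N] gathers the points in the hull of some node but of none of its children. It is null because
   [E t] is covered by the sets [E] of the children of [t]. *)
pose N := \bigcup_j (H (node j) `\` \bigcup_i H (rcons (node j) i)).
have mN : measurable N.
  apply: bigcupT_measurable => j.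
  by apply: measurableD => //; exact: bigcupT_measurable.
have N0 : mu N = 0%E.
  apply: measure_negligible => //; apply: negligible_bigcup => j.
  apply/negligibleP.
    by apply: measurableD => //; exact: bigcupT_measurable.
  apply: Hull; first exact: bigcupT_measurable.
  move=> x [Fx [r rt Ar]]; exists (r (size (node j))) => //; apply: EH;
    split => //.
  exists r => // i; rewrite size_rcons ltnS leq_eqVlt nth_rcons.
  by case/orP => [/eqP ->|it]; rewrite ?ltnn ?eqxx// it rt.
(* The default 0 is reached only on [N] or off the hull of [t]. *)
pose least (t : seq nat) (x : T) : nat :=
  if pselect (exists i, `[< H (rcons t i) x >])
    is left e then ex_minn e else 0%N.
have leastP t x : H t x -> ~ N x -> H (rcons t (least t x)) x.
  move=> Ht Nx; rewrite /least; case: pselect => [e|ne].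
    by case: ex_minnP => i /asboolP.
  exfalso; apply: Nx; have [j tj] := nodeP t; exists j => //; rewrite tj;
    split => //.
  by move=> [i _ Hi]; apply: ne; exists i; exact/asboolP.
have mleast t i : measurable [set x | least t x = i].
  pose L := H (rcons t i) `\` \bigcup_(j in [set j | (j < i)%N]) H (rcons t j).
  have mL : measurable L by apply: measurableD => //; exact: bigcup_measurable.
  rewrite (_ : [set x | _] = L `|`
      (if i == 0%N then ~` \bigcup_j H (rcons t j) else set0)); last first.
    apply/seteqP; split => x /=.
      rewrite /least; case: pselect => [e|ne <-]; last first.
        right; rewrite eqxx => -[j _ Hj].
        by apply: ne; exists j; exact/asboolP.
      case: ex_minnP => j /asboolP Hj jmin ji; left; rewrite /L -ji;
        split => //.
      move=> [l /= lj Hl]; have := jmin l; move/(_ (asboolT Hl)).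
      by rewrite leqNgt lj.
    rewrite /least; case: pselect => [e|ne].
      case: ex_minnP => j /asboolP Hj jmin [[Hi nHi]|].
        apply/eqP; rewrite eqn_leq jmin ?andTb; last exact/asboolP.
        by rewrite leqNgt; apply/negP => ji; apply: nHi; exists j.
      case: ifPn => // _ h; exfalso; apply: h.
      by exists j.
    move=> [[Hi _]|]; first by exfalso; apply: ne; exists i; exact/asboolP.
    by case: eqP.
  apply: measurableU => //; case: ifP => // _.
  by apply: measurableC; exact: bigcupT_measurable.
pose p := fix p (k : nat) (x : T) : seq nat :=
  if k is k'.+1 then rcons (p k' x) (least (p k' x) x) else [::].
have size_p k x : size (p k x) = k by elim: k => //= k IH;
  rewrite size_rcons IH.
have mp k t : measurable [set x | p k x = t].
  elim: k t => [|k IH] t /=.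
    rewrite (_ : [set x | _] = if t is [::] then setT else set0).
      by case: t.
    by apply/seteqP; split => x; case: t.
  case/lastP: t => [|t i].
    rewrite (_ : [set x | _] = set0)//; apply/seteqP; split => x //=.
    by case: (p k x).
  rewrite (_ : [set x | _] = [set x | p k x = t] `&` [set x | least t x = i]).
    exact: measurableI.
  apply/seteqP; split => x /=; last by move=> [-> ->].
  by move=> /eqP; rewrite eqseq_rcons => /andP[/eqP -> /eqP].
pose r (x : T) (k : nat) : nat := least (p k x) x.
have rp k x i : (i < k)%N -> r x i = nth 0%N (p k x) i.
  elim: k => //= k IH; rewrite ltnS leq_eqVlt => /orP[/eqP ->|ik].
    by rewrite nth_rcons size_p ltnn eqxx.
  by rewrite nth_rcons size_p ik IH.
have mr k i : measurable [set x | r x k = i].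
  rewrite (_ : [set x | _] = \bigcup_j
      ([set x | p k x = node j] `&` [set x | least (node j) x = i])).
    by apply: bigcupT_measurable => j; exact: measurableI.
  apply/seteqP; split => x.
    by move=> /= rx; have [j tj] := nodeP (p k x); exists j => //; rewrite tj.
  by move=> [j _ [/= pt lt]]; rewrite /r pt.
exists (H [::] `\` N), r; split.
- exact: measurableD.
- by move=> x [[[]]].
(* If this set were null, [H [::]] and with it [E [::]] would be negligible. *)
- rewrite lt0e measure_ge0 andbT; apply/negP => /eqP HN0; apply: E0.
  exists (H [::] `\` N `|` N); split.
  + by apply: measurableU => //; exact: measurableD.
  + by rewrite measureU0// ; exact: measurableD.
  + move=> x /EH Hx; have [Nx|Nx] := pselect (N x); [by right|by left].
- move=> k _ Y _; rewrite setTI.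
  rewrite (_ : _ @^-1` _ = \bigcup_(i in Y) [set x | r x k = i]).
    exact: bigcup_measurable.
  apply/seteqP; split => x /=; first by move=> Yr; exists (r x k).
  by move=> [i Yi /= ->].
- move=> x [Hx Nx] k.
  have Hp j : H (p j x) x by elim: j => //= j IH; exact: leastP.
  (* By locality the branch [r x] may be replaced by its initial segment [p k x], a node whose hull
     carries the condition. *)
  rewrite (Aloc _ _ (nth 0%N (p k x))); last by move=> i; exact: rp.
  by have [_] := Hp k; rewrite size_p.
Qed.

(** * Projections of measurable sets along sequences of integers *)

Definition cylinders d (A : measurableType d) : set (set (nat -> A)) :=
  [set C | exists i B, measurable B /\ C = (fun y => y i) @^-1` B].

Notation seqs A := (g_sigma_algebraType (@cylinders _ A)).

Lemma measurable_seqP d d' (T : measurableType d) (A : measurableType d')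
    (f : T -> seqs A) :
  measurable_fun setT f <-> forall i, measurable_fun setT (fun x => f x i).
Proof.
split=> [mf i|mf].
  apply: (measurableT_comp (f := fun y : seqs A => y i)) => //.
  move=> _ B mB; rewrite setTI; apply: sub_sigma_algebra.
  by exists i, B.
apply: (@measurability _ _ T (seqs A) setT f (@cylinders _ A)) =>
  // _ [_ [i [B [mB ->]]] <-].
by rewrite setTI -[X in measurable X]setTI; exact: (mf i).
Qed.

Section suslin.
Context d (T : measurableType d).
Implicit Type S : T -> (nat -> nat) -> Prop.

(* [S] is the projection along [s] of a countable intersection of sets that are
   measurable in [x] and depend on finitely many entries of [y] and [s]. *)
Definition suslin S := exists A : nat -> (nat -> nat) -> (nat -> nat) -> set T,
  [/\ forall k y s, measurable (A k y s),
      forall k y y' s s', agree k y y' -> agree k s s' -> A k y s = A k y' s' &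
      forall x y, S x y <-> exists s, forall k, A k y s x].

Lemma suslin_measurable (M : set T) : measurable M -> suslin (fun x _ => M x).
Proof.
move=> mM; exists (fun _ _ _ => M); split => // x y.
by split=> [Mx|[_ /(_ 0%N)]//]; exists (fun=> 0%N).
Qed.

(** Level [k] may look only at the entries below [k], so the condition is imposed from level [i + 1]
    on. *)
Lemma suslin_coord i (B : set nat) : suslin (fun _ y => B (y i)).
Proof.
exists (fun k y _ => [set _ | (i < k)%N -> B (y i)]); split.
- move=> k y s; have [h|h] := pselect ((i < k)%N -> B (y i)).
    by rewrite (_ : [set _ | _] = setT)//; apply/seteqP; split.
  by rewrite (_ : [set _ | _] = set0)//; apply/seteqP; split.
- by move=> k y y' s s' yy' _; apply/seteqP; split => x /= h ik; move: (h ik);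
    rewrite yy'.
- move=> x y; split=> [By|[_ /(_ i.+1 (leqnn _))]]; last exact.
  by exists (fun=> 0%N) => k /= _.
Qed.

(** The first entry of the witness names the index of the union and the remaining entries are a
    witness for that set. This shift costs one level, and level 0 imposes nothing. *)
Lemma suslin_bigcup (S : nat -> T -> (nat -> nat) -> Prop) :
  (forall i, suslin (S i)) -> suslin (fun x y => exists i, S i x y).
Proof.
move=> /choice[A HA].
exists (fun k y s =>
  if k is k'.+1 then A (s 0%N) k' y (fun i => s i.+1) else setT).
split.
- by move=> [|k] y s //; case: (HA (s 0%N)).
- move=> [|k] y y' s s' yy' ss' //; rewrite -(ss' 0%N)//.
  have [_ Aloc _] := HA (s 0%N); apply: Aloc => i ik.
    by apply: yy'; rewrite ltnW.
  exact: ss'.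
- move=> x y; split.
    move=> [i]; have [_ _ /[apply] -[s As]] := HA i.
    by exists (fun j => if j is j'.+1 then s j' else i) => -[|k].
  move=> [s As]; exists (s 0%N); have [_ _ ->] := HA (s 0%N).
  by exists (fun i => s i.+1) => k; exact: (As k.+1).
Qed.

(** A single sequence interleaves the witnesses of all the sets through the pairing of indices. *)
Lemma suslin_bigcap (S : nat -> T -> (nat -> nat) -> Prop) :
  (forall i, suslin (S i)) -> suslin (fun x y => forall i, S i x y).
Proof.
move=> /choice[A HA].
pose fib (s : nat -> nat) (i j : nat) := s (pickle (i, j)).
(* A condition enters once its entries of [s] and [y] are all visible. *)
pose vis (k i l : nat) :=
  (l <= k)%N /\ forall j, (j < l)%N -> (pickle (i, j) < k)%N.
exists (fun k y s => \bigcap_i \bigcap_l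
  [set x | vis k i l -> A i l y (fib s i) x]).
split.
- move=> k y s; apply: bigcapT_measurable => i; apply: bigcapT_measurable => l.
  have [v|v] := pselect (vis k i l).
    rewrite (_ : [set _ | _] = A i l y (fib s i)); first by case: (HA i).
    by apply/seteqP; split => x /= h; [exact: h|by []].
  by rewrite (_ : [set _ | _] = setT)//; apply/seteqP; split => [//|x _ /v].
- move=> k y y' s s' yy' ss'; apply: eq_bigcap => // i _;
    apply: eq_bigcap => // l _.
  have e : vis k i l -> A i l y (fib s i) = A i l y' (fib s' i).
    move=> [lk vl]; have [_ Aloc _] := HA i; apply: Aloc => j jl.
      by apply: yy'; exact: leq_trans lk.
    exact/ss'/vl.
  by apply/seteqP; split => x /= h v; move: (h v); rewrite e.
- move=> x y; split.
    move=> Sx; have /choice[s sP] : forall i, exists s, forall k, A i k y s x.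
      by move=> i; have [_ _ /(_ x y)[+ _]] := HA i; apply; exact: Sx.
    exists (fun c => if unpickle c is Some (i, j) then s i j else 0%N).
    move=> k i _ l _ _; rewrite (_ : fib _ i = s i) //.
    by apply/funext => j; rewrite /fib pickleK.
  move=> [s As] i; have [_ _ ->] := HA i; exists (fib s i) => l.
  (* This level is large enough for the condition of index [i] and level [l] to be visible: it
     exceeds the codes of all the entries consulted and is at least [l]. *)
  apply: (As (maxn l (\max_(j < l) (pickle (i, nat_of_ord j)).+1)) i I l I).
  split=> [|j jl]; first exact: leq_maxl.
  rewrite leq_max; apply/orP; right.
  exact: (@leq_bigmax _ (fun j : 'I_l =>
    (pickle (i, nat_of_ord j)).+1) (Ordinal jl)).
Qed.

(** Projections are closed under countable unions and intersections, but complements are not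
    evidently projections. Asking for both a set and its complement gives a sigma-algebra. *)
Definition bisuslin (C : set (T * (nat -> nat))) :=
  suslin (fun x y => C (x, y)) /\ suslin (fun x y => ~ C (x, y)).

Lemma bisuslin_sigma_algebra : sigma_algebra setT bisuslin.
Proof.
split.
- split; first exact: (suslin_measurable measurable0).
  rewrite (_ : (fun _ _ => _) = (fun x _ => setT x));
    first exact: suslin_measurable.
  by apply/funext => x; apply/funext => y; apply/propext; split=> [_|_ []];
    first exact: I.
- move=> C [C1 C2]; split.
    rewrite (_ : (fun _ _ => _) = (fun x y => ~ C (x, y)))//.
    by apply/funext => x; apply/funext => y; apply/propext; split => [[]|].
  rewrite (_ : (fun _ _ => _) = (fun x y => C (x, y)))//.
  apply/funext => x; apply/funext => y; apply/propext; split => [h|Cx []//].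
  by apply: contrapT => nC; apply: h; split.
- move=> C bC; split.
    rewrite (_ : (fun _ _ => _) = (fun x y => exists i, C i (x, y))).
      by apply: suslin_bigcup => i; case: (bC i).
    by apply/funext => x; apply/funext => y; apply/propext;
      split => [[i _]|[i]]; exists i.
  rewrite (_ : (fun _ _ => _) = (fun x y => forall i, ~ C i (x, y))).
    by apply: suslin_bigcap => i; case: (bC i).
  apply/funext => x; apply/funext => y; apply/propext;
    split => [h i Ci|h [i _]].
    by apply: h; exists i.
  exact: h.
Qed.

(** It suffices to treat preimages from the two factors, which generate the product. In the second
    factor, the sets with a bisuslin preimage form a sigma-algebra containing the cylinders. *)
Lemma measurable_bisuslin (S : set (T * seqs nat)) : measurable S -> bisuslin S.
Proof.
apply: smallest_sub; first exact: bisuslin_sigma_algebra.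
move=> _ [] [C mC <-]; rewrite setTI.
  by split; [exact: (suslin_measurable mC)|exact: (suslin_measurable
    (measurableC mC))].
suff : measurable C -> [set C | bisuslin [set z | C z.2]] C by exact.
apply: smallest_sub.
  have [b0 bD bU] := bisuslin_sigma_algebra.
  split => //= [D bD'|D bD'].
    rewrite (_ : [set z | _] = setT `\` [set z | D z.2]); first exact: bD.
    by [].
  rewrite (_ : [set z | _] = \bigcup_i [set z | D i z.2]); first exact: bU.
  by apply/seteqP; split => z [i _ Dz]; exists i.
move=> _ [i [B [_ ->]]]; split; first exact: suslin_coord.
exact: (suslin_coord i (~` B)).
Qed.

End suslin.

(** [S] is a projection along a witness sequence [s]. Choosing [y] and [s] jointly, merged entry by
    entry into one sequence, leaves only the conditions treated by [scheme_selection]. *)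
Lemma measurable_selection d (T : measurableType d) (R : realType)
    (mu : {measure set T -> \bar R}) (F : set T) (S : set (T * seqs nat)) :
  measurable F -> (mu F < +oo)%E -> measurable S ->
  ~ mu.-negligible [set x | F x /\ exists y, S (x, y)] ->
  exists (B : set T) (r : T -> seqs nat),
    [/\ measurable B, B `<=` F, (0 < mu B)%E, measurable_fun setT r &
        forall x, B x -> S (x, r x)].
Proof.
move=> mF Foo /measurable_bisuslin[[A [mA Aloc SA]] _] SN.
have [code [dec codeK]] : exists (code : nat * nat -> nat)
    (dec : nat -> nat * nat),
    cancel code dec.
  by exists pickle, (fun n => odflt (0, 0)%N (unpickle n)) => u;
    rewrite pickleK.
pose A' k (r : nat -> nat) :=
  A k (fun i => (dec (r i)).1) (fun i => (dec (r i)).2).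
have [||B [r [mB BF B0 mr Ar]]] :=
  @scheme_selection _ _ R mu F A' mF Foo (fun k r => mA k _ _).
- by move=> k r s rs; apply: Aloc => i ik; rewrite (rs i ik).
- apply: contra_not SN; apply: negligibleS => x [Fx [y /SA[s As]]].
  split => //; exists (fun i => code (y i, s i)) => k.
  rewrite /A'; have -> : (fun i => (dec (code (y i, s i))).1) = y.
    by apply/funext => i; rewrite codeK.
  have -> : (fun i => (dec (code (y i, s i))).2) = s.
    by apply/funext => i; rewrite codeK.
  exact: As.
exists B, (fun x i => (dec (r x i)).1); split => //.
  apply/measurable_seqP => i.
  by apply: (measurableT_comp (f := fun n => (dec n).1)).
move=> x Bx; apply/SA; exists (fun i => (dec (r x i)).2) => k; exact: Ar.
Qed.

(** * Coding sequences of reals by sequences of integers *)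

Section real_code.
Context (R : realType).

(** Row [i] of the code lists rationals and the real is their upper limit, which exists and is
    measurable for every code, so no convergence condition is needed; an infinite limit is read as
    0. *)
Definition real_code (y : seqs nat) (i : nat) : R :=
  fine (limn_esup (fun j =>
    (ratr (odflt 0 (unpickle (y (pickle (i, j))) : option rat)) : R)%:E)).

Lemma measurable_real_code i : measurable_fun setT (real_code ^~ i).
Proof.
apply: (measurableT_comp (f := @fine R)) => //.
apply: measurable_fun_limn_esup => j; apply/measurable_EFinP.
apply: (measurableT_comp (f := fun c : nat =>
  ratr (odflt 0 (unpickle c : option rat)) : R)) => //.
by have /measurable_seqP := @measurable_id _ (seqs nat) setT; exact.
Qed.

Lemma real_code_surj (a : nat -> R) : exists y, real_code y = a.
Proof.
have /choice[q qP] : forall ij : nat * nat, exists q : rat,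
    a ij.1 < ratr q < a ij.1 + ij.2.+1%:R^-1.
  move=> ij; have [|q] := @rat_in_itvoo R (a ij.1) (a ij.1 + ij.2.+1%:R^-1).
    by rewrite ltrDl.
  by rewrite in_itv => qP; exists q.
exists (fun c => if unpickle c is Some ij then pickle (q ij) else 0%N).
apply/funext => i; rewrite /real_code.
under eq_fun do rewrite !pickleK /=.
suff h : (ratr (q (i, j)) : R)%:E @[j --> \oo] --> (a i)%:E.
  by rewrite is_cvg_limn_esupE ?(cvg_lim _ h)//; apply/cvg_ex; exists (a i)%:E.
apply: cvg_EFin; first exact: nearW.
apply: (@squeeze_cvgr _ _ _ _ (cst (a i)) (fun j => a i + j.+1%:R^-1)).
- by apply: nearW => j /=; have /andP[/ltW -> /ltW ->] := qP (i, j).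
- exact: cvg_cst.
- by rewrite -[X in _ --> X]addr0; apply: cvgD;
    [exact: cvg_cst|exact: cvg_harmonic].
Qed.

End real_code.

(** * Borel sets of Euclidean spaces *)

Lemma measurable_fun_le_set d (T : measurableType d) (R : realType)
    (f g : T -> R) :
  measurable_fun setT f -> measurable_fun setT g ->
  measurable [set x | f x <= g x].
Proof.
move=> mf mg; rewrite -[X in measurable X]setTI.
by have := measurable_fun_ler mf mg measurableT (Y := [set true]); exact.
Qed.

(** For nonnegative values, convergence to 0 is expressed by countable quantifiers over the
    tolerance, the threshold and the index. *)
Lemma measurable_cvg0 d (Z : measurableType d) (R : realType)
    (b : nat -> Z -> R) :
  (forall i, measurable_fun setT (b i)) -> (forall i p, 0 <= b i p) ->
  measurable [set p | b i p @[i --> \oo] --> 0].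
Proof.
move=> mb b0.
rewrite (_ : [set p | _] = \bigcap_l \bigcup_N
    \bigcap_(i in [set i | (N <= i)%N]) [set p | b i p <= l.+1%:R^-1]); last first.
  apply/seteqP; split => p /=.
    move=> bp l _; have l0 : 0 < l.+1%:R^-1 :> R by rewrite invr_gt0.
    have /cvgr0Pnorm_lt/(_ _ l0)[N _ NP] := bp; exists N => // i /= /NP /=.
    by rewrite ger0_norm// => /ltW.
  move=> h; apply/cvgr0Pnorm_lt => e e0.
  have [l _ /(_ l (leqnn _)) /= le] := near_infty_natSinv_lt (PosNum e0).
  have [N _ NP] := h l I; exists N => // i /= /NP /= bl.
  by rewrite ger0_norm//; exact: le_lt_trans le.
apply: bigcapT_measurable => l; apply: bigcupT_measurable => N.
apply: bigcap_measurable; first by exists N => /=.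
by move=> i _; apply: measurable_fun_le_set => //; exact: measurable_cst.
Qed.

(** An open set is the countable union of the balls it contains that have centre [D i] and radius
    [1 / (j + 1)]. *)
Lemma measurable_open_preimage d (T : measurableType d) (R : realType)
    (V : pseudoMetricType R) (I : countType) (D : I -> V) (f : T -> V) :
  (forall x e, 0 < e -> exists i, ball x e (D i)) ->
  (forall i e, 0 < e -> measurable (f @^-1` ball (D i) e)) ->
  forall U, open U -> measurable (f @^-1` U).
Proof.
move=> dD mD U oU.
pose B (c : I * nat) : set V :=
  if `[< ball (D c.1) c.2.+1%:R^-1 `<=` U >] then ball (D c.1)
    c.2.+1%:R^-1 else set0.
rewrite (_ : U = \bigcup_c B c).
  rewrite preimage_bigcup; apply: countable_bigcupT_measurable => // c.
  by rewrite /B; case: ifP => _; [exact: mD|rewrite preimage_set0].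
apply/seteqP; split => [x Ux|x [c _]]; last by rewrite /B;
  case: asboolP => // + ?; exact.
have [e /= e0 eU] : exists2 e : R, 0 < e & ball x e `<=` U.
  by move: oU; rewrite openE => /(_ _ Ux) /nbhs_ballP.
(* A radius below [e / 2] keeps the ball about the nearby centre inside the ball of radius [e] about
   [x]. *)
have [j je] : exists j : nat, j.+1%:R^-1 < e / 2.
  have h : 0 < e / 2 by rewrite divr_gt0.
  by have [j _ /(_ j (leqnn _))] := near_infty_natSinv_lt (PosNum h); exists j.
have [i xi] := dD x j.+1%:R^-1 (ltac:(by [])).
exists (i, j) => //; rewrite /B /=; case: asboolP => [_|];
  first exact: ball_sym.
case => y iy; apply: eU; rewrite [e]splitr; apply: ball_triangle.
  by apply: le_ball xi; exact: ltW.
by apply: le_ball iy; exact: ltW.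
Qed.

Section euclid_borel.
Context (R : realType).

Definition rat_vec n (q : n.-tuple rat) : euclid R n := \row_i ratr (tnth q i).

Lemma rat_vec_dense n (x : euclid R n) (e : R) : 0 < e ->
  exists q, ball x e (rat_vec q).
Proof.
(* Dividing by [n + 1] makes the resulting bound [n * (e / (n + 1))] strictly less than [e], and
   covers [n = 0]. *)
move=> e0; have e'0 : 0 < e / n.+1%:R by rewrite divr_gt0.
have /choice[q qP] : forall i : 'I_n, exists r : rat,
    `|ratr r - x ord0 i| < e / n.+1%:R.
  move=> i; have [r] := @rat_in_itvoo R (x ord0 i - e / n.+1%:R)
    (x ord0 i + e / n.+1%:R) ltac:(by rewrite ltrD2l gtrN).
  by rewrite in_itv/= -ltr_distl => h; exists r.
exists [tuple q i | i < n]; rewrite -ball_normE /=.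
apply: (@le_lt_trans _ _ (n%:R * (e / n.+1%:R))).
  apply: euclid_norm_le_coord; first exact: ltW.
  by move=> i; rewrite !mxE tnth_mktuple distrC ltW.
by rewrite mulrC -mulrA gtr_pMr// ltr_pdivrMl// mulr1 ltr_nat.
Qed.

Lemma measurable_coord n (i : 'I_n) :
  measurable_fun [set: euclid R n] (fun x => x ord0 i : R).
Proof.
pose p (x : euclid R n) : R := x ord0 i.
have pc : continuous p.
  apply: contractive_continuous => x y.
  by have := euclid_coord_le_norm (x - y) i; rewrite !mxE.
have mp : measurable_fun [set: euclid R n] p.
  apply: (measurability _ (RGenOpens.measurableE R)).
  move=> _ [_ [a [b ->]] <-]; rewrite setTI; apply: sub_sigma_algebra.
  by apply: open_comp => //; exact: itv_open.
exact: mp.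
Qed.

Section measurable_fun.
Context d (T : measurableType d).

Lemma measurable_euclid_norm n (f : T -> euclid R n) :
  (forall i, measurable_fun setT (fun z => f z ord0 i : R)) ->
  measurable_fun setT (fun z => `|f z| : R).
Proof.
move=> mf; rewrite (_ : (fun _ => _) =
    fun z => Num.sqrt (\sum_i (f z ord0 i * f z ord0 i))); last first.
  apply/funext => z; rewrite -[LHS]ger0_norm// -sqrtr_sqr; congr Num.sqrt.
  by rewrite -inner_normE.
apply: (measurableT_comp (f := @Num.sqrt R)).
  by apply: continuous_measurable_fun; exact: sqrt_continuous.
by apply: measurable_sum => i; exact: measurable_funM.
Qed.

Lemma measurable_euclidP n (f : T -> euclid R n) : measurable_fun setT f <->
  forall i, measurable_fun setT (fun z => f z ord0 i : R).
Proof.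
split=> [mf i|mf]; first exact: measurableT_comp (measurable_coord i) mf.
apply: (@measurability _ _ _ _ _ _ (@open (euclid R n))) => // _ [U oU <-].
rewrite setTI; apply: (measurable_open_preimage (@rat_vec_dense n)) =>
  // q e e0.
rewrite -ball_normE; pose g z : R := `|rat_vec q - f z|.
rewrite (_ : _ @^-1` _ = g @^-1` `]-oo, e[%classic); last first.
  by apply/seteqP; split => z /=; rewrite in_itv.
rewrite -[X in measurable X]setTI.
suff mg : measurable_fun setT g by apply: mg => //; exact: measurable_itv.
apply: measurable_euclid_norm => i.
under eq_fun do rewrite !mxE.
by apply: measurable_funB.
Qed.

End measurable_fun.

(** Passes from the Borel sets of the product topology to the product sigma-algebra. Balls of the
    product are products of balls, and those with rational centres suffice by density. *)
Lemma borel_prod3 n m k (U : set (euclid R n * euclid R m * euclid R k)) :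
  <<s @open (euclid R n * euclid R m * euclid R k)%type >> U -> measurable U.
Proof.
apply: smallest_sub; first exact: sigma_algebra_measurable.
move=> {}U oU; rewrite -[U]preimage_id.
pose D (q : n.-tuple rat * m.-tuple rat * k.-tuple rat) :
  euclid R n * euclid R m * euclid R k :=
    (rat_vec q.1.1, rat_vec q.1.2, rat_vec q.2).
have mball l (x : euclid R l) (e : R) : 0 < e -> measurable (ball x e).
  by move=> e0; apply: sub_sigma_algebra; exact: ball_open.
apply: (@measurable_open_preimage _ _ R _ _ D) => //.
- move=> [[x y] z] e e0.
  have [p xp] := rat_vec_dense x e0; have [q yq] := rat_vec_dense y e0.
  by have [r zr] := rat_vec_dense z e0; exists (p, q, r).
- move=> [[p q] r] e e0; rewrite preimage_id.
  rewrite (_ : ball _ _ = (ball (rat_vec p) e `*` ball (rat_vec q) e)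
    `*` ball (rat_vec r) e).
    by apply: measurableX; [apply: measurableX|]; exact: mball.
  by apply/seteqP; split.
Qed.

End euclid_borel.

(** * Tangent and normal cones *)

Section inner_product.
Context (R : realType) (V : innerProductType R).
Implicit Types (u v x z : V) (U : set V).

Lemma inner0l v : inner 0 v = 0.
Proof. by rewrite -(scale0r (0 : V)) innerZl mul0r. Qed.

Lemma innerDr u v x : inner u (v + x) = inner u v + inner u x.
Proof. by rewrite !(innerC u) innerDl. Qed.

Lemma innerZr a u v : inner u (a *: v) = a * inner u v.
Proof. by rewrite !(innerC u) innerZl. Qed.

Lemma innerNr u v : inner u (- v) = - inner u v.
Proof. by rewrite -scaleN1r innerZr mulN1r. Qed.

Lemma innerNl u v : inner (- u) v = - inner u v.
Proof. by rewrite innerC innerNr innerC. Qed.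

Lemma innerBr u v x : inner u (v - x) = inner u v - inner u x.
Proof. by rewrite innerDr innerNr. Qed.

Lemma inner_le_norm u v : inner u v <= `|u| * `|v|.
Proof.
have [->|u0] := eqVneq u 0; first by rewrite inner0l normr0 mul0r.
have [->|v0] := eqVneq v 0; first by rewrite innerC inner0l normr0 mulr0.
have ugt0 : 0 < `|u| by rewrite normr_gt0.
have vgt0 : 0 < `|v| by rewrite normr_gt0.
have : 0 <= inner (`|v| *: u - `|u| *: v) (`|v| *: u - `|u| *: v).
  by rewrite inner_normE sqr_ge0.
rewrite !(innerBr, innerDl, innerNl, innerZl,
  innerZr) !inner_normE (innerC v u).
rewrite (_ : _ - _ = 2 * (`|u| * `|v|) * (`|u| * `|v| - inner u v));
  last by ring.
by rewrite pmulr_rge0 ?subr_ge0// !mulr_gt0.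
Qed.

Lemma inner_continuous z : continuous (inner z).
Proof.
(* Polarization reduces continuity of the inner product to that of the norm. *)
have pol x : inner z x = 2^-1 * (`|z + x| ^+ 2 - `|z| ^+ 2 - `|x| ^+ 2).
  by rewrite -!inner_normE innerDl !innerDr (innerC x z); field.
rewrite (funext pol) => x.
apply: cvgM; first exact: cvg_cst.
have cn y : `|z + y| ^+ 2 @[y --> x] --> `|z + x| ^+ 2.
  rewrite expr2; under eq_fun do rewrite expr2.
  by apply: cvgM; apply: cvg_norm; apply: cvgD => //; exact: cvg_cst.
apply: cvgB; last first.
  by rewrite expr2; under eq_fun do rewrite expr2; apply: cvgM; exact: cvg_norm.
by apply: cvgB; [exact: cn|apply: cvg_cst].
Qed.

Lemma cvg_inner (T : Type) (F : set_system T) (FF : Filter F) (f : T -> V) z v :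
  f x @[x --> F] --> v -> inner z (f x) @[x --> F] --> inner z v.
Proof. by move=> fv; apply: continuous_cvg fv; exact: inner_continuous. Qed.

Lemma regular_normal_coneP U u z : regular_normal_cone U u z <->
  forall e : R, 0 < e -> exists2 d : R, 0 < d &
    forall v, U v -> `|v - u| < d -> inner z (v - u) <= e * `|v - u|.
Proof.
rewrite /regular_normal_cone /= /limf_esup; split=> [zN e e0|zN].
  have [_ [A + <-] Ae] := ereal_inf_lt (le_lt_trans zN (ltac:(by rewrite
    lte_fin) : (0 < e%:E)%E)).
  rewrite /within /= => /nbhs_ballP[d /= d0 dA]; exists d => // v Uv vd.
  have [->|vu] := eqVneq v u; first by rewrite subrr normr0 mulr0 innerC
    inner0l.
  have {}dA : A v by apply: dA => //; rewrite -ball_normE /= distrC.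
  have : ((inner z (v - u) / `|v - u|)%:E < e%:E)%E.
    by apply: le_lt_trans Ae; apply: ereal_sup_ubound; exists v.
  by rewrite lte_fin ltr_pdivrMr ?normr_gt0 ?subr_eq0// => /ltW.
apply/lee_addgt0Pr => e e0; rewrite add0e.
have [d d0 dP] := zN _ e0.
apply: (@le_trans _ _ (ereal_sup ((fun v => (inner z (v - u) / `|v - u|)%:E) @`
    [set v | [/\ U v, v != u & `|v - u| < d]]))).
  apply: ereal_inf_lbound; exists [set v | [/\ U v,
    v != u & `|v - u| < d]] => //.
  rewrite /within /=; apply/nbhs_ballP; exists d => //= v.
  by rewrite -ball_normE /= distrC.
apply: ge_ereal_sup => _ [v [Uv vu vd] <-].
by rewrite lee_fin ler_pdivrMr ?normr_gt0 ?subr_eq0//; exact: dP.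
Qed.

(** Dividing the epsilon-delta inequality along the defining sequence by [tau i] and passing to the
    limit gives [inner z t <= e * |t|] for every positive [e]. *)
Lemma regular_normal_cone_polar U u z t :
  regular_normal_cone U u z -> tangent_cone U u t -> inner z t <= 0.
Proof.
move=> /regular_normal_coneP zN [tau [v [tau0 tauto0 Uv vt]]].
have vu : v i - u @[i --> \oo] --> (0 : V).
  rewrite -(scale0r t); apply: cvg_trans (cvgZ tauto0 vt).
  apply: near_eq_cvg; apply: nearW => i /=.
  by rewrite scalerA mulfV ?scale1r// gt_eqF.
have zt e : 0 < e -> inner z t <= e * `|t|.
  move=> e0; have [d d0 dP] := zN e e0.
  apply: (@ler_cvg_to _ \oo _ _ (fun i => inner z ((tau i)^-1 *: (v i - u)))
    (fun i => e * `|(tau i)^-1 *: (v i - u)|)).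
  - exact: cvg_inner.
  - by apply: cvgM; [exact: cvg_cst|exact: cvg_norm].
  have /cvgr0Pnorm_lt/(_ _ d0) := vu; apply: filterS => i vd.
  have ti : 0 <= (tau i)^-1 by rewrite invr_ge0 ltW.
  by rewrite innerZr normrZ ger0_norm// mulrCA ler_wpM2l// dP.
apply/ler_addgt0Pr => e e0; rewrite add0r.
(* The added 1 allows [t = 0]. *)
have h : 0 < e / (`|t| + 1) by rewrite divr_gt0// ltr_wpDl.
apply: le_trans (zt _ h) _.
by rewrite -mulrA ger_pMr// ler_pdivrMl ?mulr1 ?lerDl// ltr_wpDl.
Qed.

(** If [z] is not regular normal, points [v i] tending to [u] violate the inequality with a fixed
    [e]. By compactness their unit directions accumulate at some [t], which is tangent and satisfies
    [inner z t >= e]. *)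
Lemma polar_regular_normal_cone U u z : compact [set x : V | `|x| <= 1] ->
  (forall t, tangent_cone U u t -> inner z t <= 0) -> regular_normal_cone U u z.
Proof.
move=> cB zT; apply/regular_normal_coneP; apply: contrapT.
move=> /existsNP[e /not_implyP[e0 nd]].
have /choice[v vP] : forall i : nat, exists v,
    [/\ U v, `|v - u| < i.+1%:R^-1 & e * `|v - u| < inner z (v - u)].
  move=> i; apply: contrapT => nv; apply: nd; exists i.+1%:R^-1 => // v Uv vi.
  by rewrite leNgt; apply/negP => ev; apply: nv; exists v.
have vu0 i : 0 < `|v i - u|.
  rewrite normr_gt0; apply/eqP => vu; have [_ _] := vP i.
  by rewrite vu normr0 mulr0 innerC inner0l ltxx.
pose D i := `|v i - u|^-1 *: (v i - u).
have D1 i : `|D i| <= 1 by rewrite normrZ normfV normr_id mulVf// gt_eqF.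
have DB : (D @ \oo) [set x | `|x| <= 1] by exists 0%N => // i _; exact: D1.
have [t [_ tD]] := cB _ (fmap_proper_filter D eventually_filter) DB.
(* The indices [j i] need not increase; [i <= j i] is enough for the distances to [u] to tend to
   0. *)
have /choice[j jP] : forall i : nat, exists j,
  (i <= j)%N /\ `|t - D j| < i.+1%:R^-1.
  move=> i.
  have Ai : (D @ \oo) (D @` [set j | (i <= j)%N]).
    by exists i => // j ij; exists j.
  have Bi : nbhs t (ball t i.+1%:R^-1) by exact: nbhsx_ballx.
  have [_ [[j ij <-]]] := tD _ _ Ai Bi.
  by rewrite -ball_normE => ?; exists j.
have Dt : D (j i) @[i --> \oo] --> t.
  apply/cvgrPdist_lt => d d0.
  have := near_infty_natSinv_lt (PosNum d0); apply: filterS => i /=.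
  by apply: lt_trans; case: (jP i).
have : inner z t <= 0.
  apply: zT; exists (fun i => `|v (j i) - u|), (fun i => v (j i)); split => //.
  - apply: (@squeeze_cvgr _ _ _ _ (cst 0) (fun i => i.+1%:R^-1)) => //.
    + apply: nearW => i /=; rewrite ltW//=.
      have [_ /ltW vj _] := vP (j i); apply: (le_trans vj).
      by rewrite lef_pV2 ?posrE// ler_nat ltnS; case: (jP i).
    + exact: cvg_cst.
    + exact: cvg_harmonic.
  - by move=> i; case: (vP (j i)).
apply/negP; rewrite -ltNge; apply: (lt_le_trans e0).
apply: (@ler_cvg_to _ \oo _ _ (fun=> e) (fun i => inner z (D (j i)))).
- exact: cvg_cst.
- exact: cvg_inner.
- apply: nearW => i; have [_ _ /ltW] := vP (j i).
  by rewrite innerZr ler_pdivlMl ?vu0// mulrC.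
Qed.

End inner_product.

(** Derivability allows the steps to be prescribed. Using [1 / (i + 1)] at every base point lets
    pointwise tangent sequences be assembled later into one sequence in L^2. *)
Lemma geometrically_derivable_seq (R : realType) (V : innerProductType R)
    (U : set V) (u t : V) :
  geometrically_derivable U -> U u -> tangent_cone U u t ->
  exists2 v : nat -> V, (forall i, U (v i)) &
    i.+1%:R *: (v i - u) @[i --> \oo] --> t.
Proof.
move=> gU Uu /(gU _ _ Uu)[e [xi [e0 Uxi xi0 xit]]].
(* The curve is only known to lie in [U] up to time [e]; for the finitely many larger steps [u] is a
   placeholder. *)
exists (fun i => if (i.+1%:R^-1 <= e) then xi i.+1%:R^-1 else u).
  by move=> i; case: ifP => // ie; apply: Uxi; rewrite ie invr_ge0 ler0n.
apply/cvgrPdist_lt => eps eps0.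
have /cvgrPdist_lt/(_ _ eps0)[del /= del0 delP] := xit.
have hme : 0 < Num.min e del by rewrite lt_min e0.
have := near_infty_natSinv_lt (PosNum hme); apply: filterS => i /=.
rewrite lt_min => /andP[/ltW ie idel]; rewrite ie.
have := delP i.+1%:R^-1; rewrite invrK xi0; apply.
  by rewrite /= sub0r normrN ger0_norm// invr_ge0.
by rewrite invr_gt0.
Qed.

(** * The Hilbert product and compactness of its unit ball *)

Section hprod.
Context (R : realType) (V W : innerProductType R).
Implicit Type x : hprod V W.

Lemma hprod_normE x : `|x| ^+ 2 = `|x.1| ^+ 2 + `|x.2| ^+ 2.
Proof. by rewrite -!inner_normE. Qed.

Lemma hprod_norm_le x : `|x| <= `|x.1| + `|x.2|.
Proof.
rewrite -(@ler_pXn2r _ 2) ?nnegrE ?addr_ge0// hprod_normE sqrrD.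
by rewrite addrAC lerDl mulrn_wge0// mulr_ge0.
Qed.

Lemma hprod_fst_le x : `|x.1| <= `|x|.
Proof. by rewrite -(@ler_pXn2r _ 2) ?nnegrE// hprod_normE lerDl sqr_ge0. Qed.

Lemma hprod_snd_le x : `|x.2| <= `|x|.
Proof. by rewrite -(@ler_pXn2r _ 2) ?nnegrE// hprod_normE lerDr sqr_ge0. Qed.

End hprod.

(** The Euclidean unit ball is a closed subset of the image of a compact box under the Lipschitz map
    [phi], which splits a row vector carrying the sup norm. *)
Lemma hprod_euclid_unit_ball_compact (R : realType) m k :
  compact [set x : hprod (euclid R m) (euclid R k) | `|x| <= 1].
Proof.
pose phi (v : 'rV[R]_(m + k)) : hprod (euclid R m) (euclid R k) :=
  (lsubmx v : euclid R m, rsubmx v : euclid R k).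
have coord (v : 'rV[R]_(m + k)) i : `|v ord0 i| <= `|v|.
  rewrite [leRHS]mx_normrE.
  exact: (@le_bigmax _ _ _ _ (fun ij : 'I_1 * 'I_(m + k) =>
    `|v ij.1 ij.2|) (ord0, i)).
have phi_le v : `|phi v| <= (m%:R + k%:R) * `|v|.
  apply: (le_trans (hprod_norm_le _)); rewrite mulrDl lerD//.
    by apply: euclid_norm_le_coord => // i; rewrite mxE.
  by apply: euclid_norm_le_coord => // i; rewrite mxE.
have phiB v w : phi v - phi w = phi (v - w).
  by congr pair; apply/rowP => i; rewrite !mxE.
have phi_c : continuous phi.
  move=> v; apply/(@cvgrPdist_lt _ _ _ _ (nbhs_filter v)) => e e0.
  (* The added 1 keeps the Lipschitz constant positive when [m] and [k] are both 0. *)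
  have c0 : 0 < m%:R + k%:R + 1 :> R by rewrite ltr_wpDl// addr_ge0.
  have : \forall w \near v, `|v - w| < (m%:R + k%:R + 1)^-1 * e.
    apply/nbhs_ballP; exists ((m%:R + k%:R + 1)^-1 * e) => /= [|w].
      by rewrite mulr_gt0// invr_gt0.
    by rewrite -ball_normE.
  apply: filterS => w; rewrite ltr_pdivlMl// => vw.
  rewrite phiB; apply: (le_lt_trans (phi_le _)); apply: le_lt_trans vw.
  by rewrite ler_wpM2r// lerDl.
pose box := [set v : 'rV[R]_(m + k) | forall i, `[(-1)%R,
  1%R]%classic (v ord0 i)].
have cbox : compact box.
  apply: (@rV_compact R _ (fun=> `[(-1)%R, 1%R]%classic)) => _.
  exact: segment_compact.
apply: (@subclosed_compact _ _ (phi @` box)).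
- rewrite (_ : [set _ | _] = (fun x => `|x|) @^-1` [set x | x <= 1])//.
  apply: preimage_closed; last exact: closed_le.
  by move=> x _; exact: norm_continuous.
- by apply: continuous_compact => //; exact: continuous_subspaceT.
- move=> x x1; exists (row_mx (x.1 : 'rV[R]_m) (x.2 : 'rV[R]_k)); last first.
    by rewrite /phi row_mxKl row_mxKr; case: x x1.
  move=> i /=; rewrite in_itv /= -ler_norml mxE; case: splitP => j _.
    exact/(le_trans _ x1)/(le_trans _ (hprod_fst_le x))/euclid_coord_le_norm.
  exact/(le_trans _ x1)/(le_trans _ (hprod_snd_le x))/euclid_coord_le_norm.
Qed.

(** * Pairs of square-integrable functions *)

Section measurable_hprod.
Context d (T : measurableType d) (R : realType) (m k : nat).
Local Notation H := (hprod (euclid R m) (euclid R k)).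
Implicit Types f g : T -> H.

Definition measurable_hprod f :=
  measurable_fun setT (fun x => (f x).1 : euclid R m) /\
  measurable_fun setT (fun x => (f x).2 : euclid R k).

Lemma measurable_hprod_inner f g : measurable_hprod f -> measurable_hprod g ->
  measurable_fun setT (fun x => inner (f x) (g x) : R).
Proof.
move=> [/measurable_euclidP f1 /measurable_euclidP f2].
move=> [/measurable_euclidP g1 /measurable_euclidP g2].
by apply: measurable_funD; apply: measurable_sum => i; exact: measurable_funM.
Qed.

Lemma measurable_hprod_norm f : measurable_hprod f ->
  measurable_fun setT (fun x => `|f x| : R).
Proof.
move=> mf; rewrite (_ : (fun _ => _) = fun x => Num.sqrt (inner (f x) (f x))).
  apply: (measurableT_comp (f := @Num.sqrt R)).
    by apply: continuous_measurable_fun; exact: sqrt_continuous.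
  exact: measurable_hprod_inner.
by apply/funext => x; rewrite inner_normE sqrtr_sqr normr_id.
Qed.

Lemma measurable_hprodB f g : measurable_hprod f -> measurable_hprod g ->
  measurable_hprod (fun x => f x - g x).
Proof.
move=> [/measurable_euclidP f1 /measurable_euclidP f2].
move=> [/measurable_euclidP g1 /measurable_euclidP g2].
split; apply/measurable_euclidP => i; under eq_fun do rewrite !mxE;
  exact: measurable_funB.
Qed.

Lemma measurable_hprodZ (a : R) f : measurable_hprod f ->
  measurable_hprod (fun x => a *: f x).
Proof.
move=> [/measurable_euclidP f1 /measurable_euclidP f2].
by split; apply/measurable_euclidP => i; under eq_fun do rewrite !mxE;
  exact: measurable_funM.
Qed.

Lemma measurable_hprod_if (B : set T) f g : measurable B ->
  measurable_hprod f -> measurable_hprod g ->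
  measurable_hprod (fun x => if x \in B then f x else g x).
Proof.
have mB' : measurable B -> measurable_fun setT (fun x => x \in B).
  move=> mB; apply: (measurable_fun_bool true).
  by rewrite setTI (_ : _ @^-1` _ = B)//; apply/seteqP; split => x /=;
    [exact: set_mem|exact: mem_set].
move=> /mB' mB [f1 f2] [g1 g2]; split.
  rewrite (_ : (fun _ => _) = fun x => if x \in B then (f x).1 else (g x).1).
    exact: measurable_fun_ifT.
  by apply/funext => x; case: ifP.
rewrite (_ : (fun _ => _) = fun x => if x \in B then (f x).2 else (g x).2).
  exact: measurable_fun_ifT.
by apply/funext => x; case: ifP.
Qed.

End measurable_hprod.

Lemma measurable_hprod_comp d1 d2 (T1 : measurableType d1)
    (T2 : measurableType d2) (R : realType) (m k : nat)
    (f : T2 -> hprod (euclid R m) (euclid R k)) (g : T1 -> T2) :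
  measurable_hprod f -> measurable_fun setT g -> measurable_hprod (f \o g).
Proof.
move=> [f1 f2] mg; split.
  exact: measurableT_comp f1 mg.
exact: measurableT_comp f2 mg.
Qed.

Section L2_pair.
Context d (T : measurableType d) (R : realType).
Context (mu : {measure set T -> \bar R}).
Context (m k : nat).
Local Notation H := (hprod (euclid R m) (euclid R k)).
Local Notation LL := (hprod (L2 mu m) (L2 mu k)).
Implicit Types u v : LL.

(** Reads a pair of L^2 classes as one function into the Hilbert product, so that inner products and
    norms are integrals of pointwise ones. Representatives being arbitrary, it is linear only almost
    everywhere. *)
Definition pair_fun u (x : T) : H := (L2_fun u.1 x, L2_fun u.2 x).

Lemma measurable_L2_fun l (f : L2 mu l) : measurable_fun setT (L2_fun f).
Proof.
apply/measurable_euclidP => i; have := L2_fun_Lfun f i.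
by rewrite inE => /andP[/[!inE]].
Qed.

Lemma measurable_pair_fun u : measurable_hprod (pair_fun u).
Proof. by split; exact: measurable_L2_fun. Qed.

Lemma integrable_L2_inner l (f g : L2 mu l) :
  mu.-integrable setT (EFin \o (fun x => inner (L2_fun f x) (L2_fun g x))).
Proof.
rewrite (_ : _ \o _ = fun x =>
    (\sum_(i < l) (L2_fun f x ord0 i * L2_fun g x ord0 i)%:E)%E); last first.
  by apply/funext => x /=; rewrite sumEFin.
apply: integrable_sum => // i _; apply/Lfun1_integrable.
exact: Lfun2_mul_Lfun1 (L2_fun_Lfun f i) (L2_fun_Lfun g i).
Qed.

Lemma integrable_pair_inner u v :
  mu.-integrable setT (EFin \o (fun x => inner (pair_fun u x) (pair_fun v x))).
Proof.
rewrite (_ : _ \o _ =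
  (EFin \o (fun x => inner (L2_fun u.1 x) (L2_fun v.1 x))) \+
  (EFin \o (fun x => inner (L2_fun u.2 x) (L2_fun v.2 x))))%E//.
by apply: integrableD => //; exact: integrable_L2_inner.
Qed.

Lemma pair_innerE u v :
  inner u v = Rintegral mu setT (fun x => inner (pair_fun u x) (pair_fun v x)).
Proof.
rewrite -[LHS]/(L2_inner u.1 v.1 + L2_inner u.2 v.2) /L2_inner -RintegralD//;
  exact: integrable_L2_inner.
Qed.

Lemma pair_normE u :
  (`|u| ^+ 2)%:E = (\int[mu]_x (`|pair_fun u x| ^+ 2)%:E)%E.
Proof.
rewrite -inner_normE pair_innerE.
under eq_integral do rewrite -inner_normE.
by rewrite fineK//; exact: integrable_fin_num (integrable_pair_inner u u).
Qed.

Lemma pair_funB u v : \forall x \ae mu,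
  pair_fun (u - v) x = pair_fun u x - pair_fun v x.
Proof.
have L2_funB l (f g : L2 mu l) : \forall x \ae mu,
  L2_fun (f - g) x = L2_fun f x - L2_fun g x.
  rewrite -scaleN1r; apply: filterS2 (L2_funD f (-1 *: g)) (L2_funZ (-1) g)
    => x -> ->.
  by rewrite scaleN1r.
by apply: filterS2 (L2_funB _ u.1 v.1) (L2_funB _ u.2 v.2) => x;
  rewrite /pair_fun /= => -> ->.
Qed.

Lemma pair_funD u v : \forall x \ae mu,
  pair_fun (u + v) x = pair_fun u x + pair_fun v x.
Proof.
by apply: filterS2 (L2_funD u.1 v.1) (L2_funD u.2 v.2) => x;
  rewrite /pair_fun /= => -> ->.
Qed.

Lemma pair_funZ a u : \forall x \ae mu, pair_fun (a *: u) x = a *: pair_fun u x.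
Proof.
by apply: filterS2 (L2_funZ a u.1) (L2_funZ a u.2) => x;
  rewrite /pair_fun /= => -> ->.
Qed.

(** Each coordinate is bounded by the norm, so square integrability of the norm puts every component
    in the scalar L^2. *)
Lemma L2_lift l (f : T -> euclid R l) : measurable_fun setT f ->
  (\int[mu]_x (`|f x| ^+ 2)%:E < +oo)%E ->
  exists u : L2 mu l, \forall x \ae mu, L2_fun u x = f x.
Proof.
move=> /measurable_euclidP mf foo.
have fL : f \in @L2fun _ T R mu l.
  apply/forallP => i; rewrite inE/=; apply/andP; split; rewrite inE//=.
  rewrite /finite_norm unlock /Lnorm poweR_lty//; apply: le_lt_trans foo.
  apply: ge0_le_integral => //.
  - move=> x _; exact: poweR_ge0.
  - under eq_fun do rewrite /= powR_mulrn// -normrX.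
    by apply/measurable_EFinP/measurableT_comp => //; exact: measurable_funX.
  - by apply/measurable_EFinP/measurable_funX/measurable_euclid_norm.
  - move=> x _ /=; rewrite powR_mulrn// lee_fin.
    by rewrite ler_pXn2r ?nnegrE// euclid_coord_le_norm.
by exists (L2_class (Sub f fL : L2fun_type mu l)); exact: L2_class_ae.
Qed.

Lemma pair_lift (f : T -> H) : measurable_hprod f ->
  (\int[mu]_x (`|f x| ^+ 2)%:E < +oo)%E ->
  exists u : LL, \forall x \ae mu, pair_fun u x = f x.
Proof.
move=> [f1 f2] foo.
have mn := measurable_hprod_norm (conj f1 f2).
have [u uf] : exists u : L2 mu m, \forall x \ae mu, L2_fun u x = (f x).1.
  apply: L2_lift => //; apply: le_lt_trans foo; apply: ge0_le_integral => //.
  - apply/measurable_EFinP/measurable_funX/measurable_euclid_norm => i.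
    exact: ((measurable_euclidP _).1 f1 i).
  - exact/measurable_EFinP/measurable_funX.
  - by move=> x _; rewrite lee_fin ler_pXn2r ?nnegrE// hprod_fst_le.
have [v vf] : exists v : L2 mu k, \forall x \ae mu, L2_fun v x = (f x).2.
  apply: L2_lift => //; apply: le_lt_trans foo; apply: ge0_le_integral => //.
  - apply/measurable_EFinP/measurable_funX/measurable_euclid_norm => i.
    exact: ((measurable_euclidP _).1 f2 i).
  - exact/measurable_EFinP/measurable_funX.
  - by move=> x _; rewrite lee_fin ler_pXn2r ?nnegrE// hprod_snd_le.
exists (u, v); apply: filterS2 uf vf => x; rewrite /pair_fun /= => -> ->.
by case: (f x).
Qed.

Lemma bounded_on_square_integrable (B : set T) (f : T -> H) (C : R) :
  measurable B -> (mu B < +oo)%E -> measurable_hprod f ->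
  (forall x, B x -> `|f x| <= C) ->
  (\int[mu]_x (`|if x \in B then f x else 0| ^+ 2)%:E < +oo)%E.
Proof.
move=> mB Boo mf fC.
have m0 : measurable_hprod (fun=> 0 : H) by split; exact: measurable_cst.
apply: (@le_lt_trans _ _ (\int[mu]_x ((C ^+ 2)%:E * (\1_B x)%:E))%E).
  apply: ge0_le_integral => //.
  - by apply/measurable_EFinP/measurable_funX/measurable_hprod_norm/measurable_hprod_if.
  - apply/measurable_EFinP; apply: measurable_funM; first exact: measurable_cst.
    exact: measurable_indic.
  - move=> x _; rewrite -EFinM lee_fin indicE; case: ifPn => xB.
      have fx := fC _ (set_mem xB).
      by rewrite mulr1 ler_pXn2r ?nnegrE// (le_trans _ fx).
    by rewrite normr0 expr0n /= mulr0.
rewrite ge0_integralZl//; last first.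
- by rewrite lee_fin sqr_ge0.
- by apply/measurable_EFinP; exact: measurable_indic.
by rewrite integral_indic// setIT lte_mul_pinfty// lee_fin sqr_ge0.
Qed.

End L2_pair.

(** * Normal and tangent cones of sets of L^2 selections *)

Section pointwise_cones.
Context d (T : measurableType d) (R : realType).
Context (mu : {measure set T -> \bar R}).
Context (m k : nat).
Local Notation H := (hprod (euclid R m) (euclid R k)).
Local Notation LL := (hprod (L2 mu m) (L2 mu k)).
Implicit Types u v z : LL.

(** The squared norms are summable, so the series of the pointwise squares has a finite integral. It
    therefore converges almost everywhere and its terms tend to 0. *)
Lemma ae_cvg_summable (h : nat -> LL) :
  (forall j, `|h j| <= 2^-1 ^+ j) ->
  \forall x \ae mu, `|pair_fun (h j) x| ^+ 2 @[j --> \oo] --> (0 : R).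
Proof.
move=> hj; pose f j x : \bar R := (`|pair_fun (h j) x| ^+ 2)%:E.
have mf j : measurable_fun setT (f j).
  by apply/measurable_EFinP/measurable_funX/measurable_hprod_norm/measurable_pair_fun.
have f0 j x : (0 <= f j x)%E by rewrite lee_fin sqr_ge0.
pose F x := (\sum_(0 <= j <oo) f j x)%E.
have F0 x : (0 <= F x)%E by exact: nneseries_ge0.
have mF : measurable_fun setT F by exact: ge0_emeasurable_sum.
have Foo : (\int[mu]_x F x < +oo)%E.
  rewrite integral_nneseries//.
  apply: (@le_lt_trans _ _ (\sum_(0 <= j <oo) (2^-1 ^+ j)%:E)%E).
    apply: lee_nneseries => j _ //.
      by move=> _; exact: integral_ge0.
    rewrite /f -pair_normE lee_fin; apply: (le_trans (y := (2^-1 ^+ j) ^+ 2)).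
      by rewrite ler_pXn2r ?nnegrE.
    rewrite expr2 ler_piMr// exprn_ile1//.
    by rewrite invf_le1// ler1n.
  have half1 : `|2^-1 : R| < 1 by rewrite ger0_norm// invf_lt1// ltr1n.
  have sumE : (\sum_(0 <= j < n) (2^-1 ^+ j)%:E)%E @[n --> \oo]
    --> (1 / (1 - 2^-1) : R)%:E.
    under eq_fun do rewrite sumEFin.
    apply: cvg_EFin; first exact: nearW.
    rewrite [X in X @ _](_ : _ = series (geometric 1 2^-1)); last first.
      by apply/funext => n /=; rewrite /series /geometric;
        apply: eq_bigr => j _; rewrite /= mul1r.
    exact: cvg_geometric_series.
  by rewrite (cvg_lim _ sumE)// ltry.
have : mu.-integrable setT F.
  apply/integrableP; split => //.
  by under eq_integral do rewrite gee0_abs//.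
move=> /(integrable_ae measurableT); apply: filterS => x /(_ I) Fx.
apply: cvg_series_cvg_0.
apply: nondecreasing_is_cvgn.
  by apply/nondecreasing_seqP => n;
    rewrite /series /= big_nat_recr//= lerDl sqr_ge0.
exists (fine (F x)) => _ [n _ <-].
rewrite -lee_fin fineK// /series /= -sumEFin.
exact: nneseries_lim_ge.
Qed.

Lemma pointwise_regular_normal (G : T -> set H) u z :
  (\forall x \ae mu, regular_normal_cone (G x) (pair_fun u x) (pair_fun z x)) ->
  regular_normal_cone [set v : LL | \forall x \ae mu, G x (pair_fun v x)] u z.
Proof.
move=> zN; apply/regular_normal_coneP; apply: contrapT.
move=> /existsNP[e /not_implyP[e0 nd]].
have /choice[v vP] : forall j : nat, exists v : LL,
    [/\ \forall x \ae mu, G x (pair_fun v x), `|v - u| < 2^-1 ^+ j &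
        e * `|v - u| < inner z (v - u)].
  move=> j; apply: contrapT => nv; apply: nd; exists (2^-1 ^+ j) => // v Uv vj.
  by rewrite leNgt; apply/negP => ev; apply: nv; exists v.
pose h j := v j - u.
have h0 j : 0 < `|h j|.
  rewrite normr_gt0; apply/eqP => vu; have [_ _] := vP j.
  by rewrite -/(h j) vu normr0 mulr0 innerC inner0l ltxx.
have hj j : `|h j| <= 2^-1 ^+ j by have [_ /ltW] := vP j.
(* Chosen so that [eta * |z|] is at most [e / 2], also when [z = 0]. *)
pose eta := e / (2 * (`|z| + 1)).
have eta0 : 0 < eta by rewrite divr_gt0// mulr_gt0// ltr_wpDl.
have etaz : (eta * `|z|) ^+ 2 <= e ^+ 2 / 4.
  rewrite (_ : e ^+ 2 / 4 = (e / 2) ^+ 2); last by field.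
  have z1 : 0 < `|z| + 1 by rewrite ltr_wpDl.
  have e2 : 0 <= e / 2 by rewrite divr_ge0// ltW.
  rewrite ler_pXn2r ?nnegrE ?mulr_ge0 ?(ltW eta0) ?(ltW e0)// /eta.
  rewrite (_ : _ * `|z| = e / 2 * (`|z| / (`|z| + 1))); last by field;
    rewrite gt_eqF.
  rewrite ler_piMr//.
  by rewrite ler_pdivrMr// mul1r lerDl.
pose far j x : bool := eta * (`|pair_fun z x| * `|pair_fun (h j) x|) <
  inner (pair_fun z x) (pair_fun (h j) x).
pose g j x : R := if far j x then `|pair_fun z x| ^+ 2 else 0.
have mn (y : LL) : measurable_fun setT (fun x => `|pair_fun y x| : R).
  exact/measurable_hprod_norm/measurable_pair_fun.
have mg j : measurable_fun setT (g j).
  apply: measurable_fun_ifT => //; last exact: measurable_funX.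
  apply: measurable_fun_ltr.
    by apply: measurable_funM => //; exact: measurable_funM.
  by apply: measurable_hprod_inner; exact: measurable_pair_fun.
have iz (y : LL) : mu.-integrable setT (EFin \o (fun x =>
  `|pair_fun y x| ^+ 2)).
  rewrite (_ : (fun x => `|pair_fun y x| ^+ 2) =
      fun x => inner (pair_fun y x) (pair_fun y x)).
    exact: integrable_pair_inner.
  by apply/funext => x; rewrite inner_normE.
have g0 : \forall x \ae mu, g j x @[j --> \oo] --> (0 : R).
  have hx : \forall x \ae mu, forall j,
    pair_fun (h j) x = pair_fun (v j) x - pair_fun u x.
    by apply: ae_foralln => j; exact: pair_funB.
  have Gx : \forall x \ae mu, forall j, G x (pair_fun (v j) x).
    by apply: ae_foralln => j; case: (vP j).
  have h2 := ae_cvg_summable hj.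
  apply: filterS2 (filterI zN hx) (filterI Gx h2) => x [zNx {}hx] [{}Gx {}h2].
  (* This case is split off because the tolerance [eta * |z x|] used next must be positive. *)
  have [zx0|zx0] := eqVneq (pair_fun z x) 0.
    under eq_fun do rewrite /g zx0 normr0 expr0n /= if_same.
    exact: cvg_cst.
  have /regular_normal_coneP/(_ (eta * `|pair_fun z x|)) := zNx.
  case; first by rewrite mulr_gt0// normr_gt0.
  move=> del del0 delP.
  apply: cvg_near_cst.
  have /cvgr0Pnorm_lt/(_ (del ^+ 2)) := h2.
  move=> /(_ (exprn_gt0 _ del0)); apply: filterS => j.
  rewrite ger0_norm ?sqr_ge0// ltr_pXn2r ?nnegrE ?(ltW del0)// => hdel.
  rewrite /g ifF//; apply/negbTE; rewrite -leNgt hx mulrA; apply: delP => //.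
  by rewrite -hx.
pose a j : \bar R := (\int[mu]_x (g j x)%:E)%E.
have a0 : a j @[j --> \oo] --> 0%E.
  have [|||||_ _] := @dominated_convergence _ _ R mu setT measurableT
    (fun j => EFin \o g j) (cst 0%E) (EFin \o (fun x => `|pair_fun z x| ^+ 2)).
  - by move=> j; exact/measurable_EFinP.
  - exact: measurable_cst.
  - by apply: filterS g0 => x gx _; apply: cvg_EFin => //; exact: nearW.
  - exact: iz.
  - apply: aeW => x j _ /=; rewrite lee_fin /g.
    by case: ifP => _; rewrite ?normr0 ?sqr_ge0// ger0_norm ?sqr_ge0.
  - by rewrite integral0.
have ig j : mu.-integrable setT (EFin \o g j).
  apply: (le_integrable _ _ _ (iz z)) => //; first exact/measurable_EFinP.
  move=> x _ /=; rewrite lee_fin /g.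
  by case: ifP => _; rewrite ?normr0.
have normE (y : LL) : Rintegral mu setT (fun x => `|pair_fun y x| ^+ 2) =
    `|y| ^+ 2.
  by rewrite -inner_normE pair_innerE; apply: eq_Rintegral => x _;
    rewrite inner_normE.
have bound j : e ^+ 2 <= Rintegral mu setT (g j) + (eta * `|z|) ^+ 2.
  have hjgt0 := h0 j; set r := `|h j| in hjgt0 *.
  (* The weights satisfy [4 * A * C = 1] and [C * r ^+ 2 = e * r / 2], so the last term absorbs half
     of the lower bound [e * r]. *)
  pose A := r / (2 * e); pose C := e / (2 * r).
  have A0 : 0 < A by rewrite divr_gt0// mulr_gt0.
  (* AM-GM: [A s^2 - s t + C t^2] is a square because [4 A C = 1] *)
  have amgm s t : s * t <= A * s ^+ 2 + C * t ^+ 2.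
    rewrite -subr_ge0 (_ : _ - _ = A * (s - e / r * t) ^+ 2).
      by rewrite mulr_ge0 ?sqr_ge0// ltW.
    by rewrite /A /C; field; rewrite !gt_eqF.
  have iAg : mu.-integrable setT (EFin \o (fun x => A * g j x)).
    exact: (integrableZl measurableT A (ig j)).
  have iBz : mu.-integrable setT (EFin \o (fun x =>
    eta ^+ 2 * A * `|pair_fun z x| ^+ 2)).
    exact: (integrableZl measurableT (eta ^+ 2 * A) (iz z)).
  have iCh : mu.-integrable setT (EFin \o (fun x =>
    C * `|pair_fun (h j) x| ^+ 2)).
    exact: (integrableZl measurableT C (iz (h j))).
  have iAB : mu.-integrable setT
      (EFin \o (fun x => A * g j x + eta ^+ 2 * A * `|pair_fun z x| ^+ 2)).
    exact: (integrableD measurableT iAg iBz).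
  have le_int : inner z (h j) <= A * Rintegral mu setT (g j) +
      eta ^+ 2 * A * `|z| ^+ 2 + C * `|h j| ^+ 2.
    rewrite -(normE z) -(normE (h j)) -(RintegralZl _ measurableT (ig j)).
    rewrite -(RintegralZl _ measurableT (iz z))
      -(RintegralZl _ measurableT (iz (h j))).
    rewrite -(RintegralD measurableT iAg iBz)
      -(RintegralD measurableT iAB iCh) pair_innerE.
    apply: (le_Rintegral measurableT (integrable_pair_inner _ _)).
      exact: (integrableD measurableT iAB iCh).
    move=> x _; rewrite /g.
    (* On the far set Cauchy-Schwarz applies pointwise; off it the factor [eta] is gained. *)
    case: ifPn => [_|].
      apply: (le_trans (inner_le_norm _ _)); apply: (le_trans (amgm _ _)).
      have A0' := ltW A0.
      by rewrite lerD2r lerDl mulr_ge0 ?sqr_ge0// mulr_ge0 ?sqr_ge0.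
    rewrite -leNgt mulr0 add0r mulrA => /le_trans; apply.
    by apply: (le_trans (amgm _ _)); rewrite exprMn mulrCA mulrA.
  have [_ _ /lt_le_trans/(_ le_int)] := vP j.
  rewrite -/r (_ : _ + C * _ = r * ((Rintegral mu setT (g j) +
      (eta * `|z|) ^+ 2) / (2 * e) + e / 2)); last first.
    by rewrite /A /C -/r; field; rewrite !gt_eqF.
  rewrite mulrC ltr_pM2l// -ltrBlDr ltr_pdivlMr ?mulr_gt0// => /ltW;
    apply: le_trans.
  by rewrite le_eqVlt; apply/orP; left; apply/eqP; field.
have /fine_cvgP[_ /cvgr0Pnorm_lt/(_ (e ^+ 2 / 2))] := a0.
move=> /(_ (divr_gt0 (exprn_gt0 _ e0) (ltr0Sn _ 1))) [j _ /(_ j (leqnn _))] /=.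
(* The integral of [g j] is now below [e ^+ 2 / 2] and the other term is at most [e ^+ 2 / 4], which
   contradicts [bound]. *)
move=> /(le_lt_trans (ler_norm _)) aj; have := bound j;
  rewrite leNgt => /negP; apply.
apply: (lt_le_trans (ltr_leD aj etaz)).
have : 0 <= e ^+ 2 by exact: sqr_ge0.
lra.
Qed.

End pointwise_cones.

(** * Coding sequences of finite-dimensional pairs *)

Section hprod_code.
Context (R : realType) (m k : nat).
Local Notation H := (hprod (euclid R m) (euclid R k)).

Definition hprod_code (y : seqs nat) (i : nat) : H :=
  (\row_j real_code R y (pickle (i, (false, nat_of_ord j))),
   \row_j real_code R y (pickle (i, (true, nat_of_ord j)))).

Lemma measurable_hprod_code i : measurable_hprod (hprod_code ^~ i).
Proof.
split; apply/measurable_euclidP => j.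
  have := @measurable_real_code R (pickle (i, (false, nat_of_ord j))).
  by apply: eq_measurable_fun => y _; rewrite /hprod_code mxE.
have := @measurable_real_code R (pickle (i, (true, nat_of_ord j))).
by apply: eq_measurable_fun => y _; rewrite /hprod_code mxE.
Qed.

Lemma hprod_code_surj (w : nat -> H) : exists y, hprod_code y = w.
Proof.
pose entry (i : nat) (b : bool) (j : nat) : R :=
  if b then odflt 0 (omap (fun o => (w i).2 ord0 o) (insub j))
  else odflt 0 (omap (fun o => (w i).1 ord0 o) (insub j)).
have [y yE] := real_code_surj (fun c =>
  if unpickle c is Some (i, (b, j)) then entry i b j else 0).
exists y; apply/funext => i; rewrite /hprod_code yE.
case E : (w i) => [a b]; congr pair; apply/rowP => j;
  rewrite !mxE pickleK /entry valK /= E //.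
Qed.

End hprod_code.

(** * Tangent vectors in L^2 from pointwise ones *)

Section tangent_selection.
Context d (T : measurableType d) (R : realType).
Context (mu : {measure set T -> \bar R}).
Context (m k : nat).
Local Notation H := (hprod (euclid R m) (euclid R k)).
Local Notation LL := (hprod (L2 mu m) (L2 mu k)).
Implicit Types u v z : LL.
Context (G : T -> set H) (mG :
  measurable ([set t | G t.1 t.2] : set (T * (euclid R m * euclid R k)))).

Lemma measurable_mem_graph d' (Z : measurableType d') (f : Z -> T)
    (g : Z -> H) :
  measurable_fun setT f -> measurable_hprod g ->
    measurable [set p | G (f p) (g p)].
Proof.
move=> mf [g1 g2].
have mfg : measurable_fun setT
    (fun p => (f p, ((g p).1, (g p).2)) : T * (euclid R m * euclid R k)).
  by apply: measurable_fun_pair => //; exact: measurable_fun_pair.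
have := mfg measurableT _ mG; rewrite setTI.
rewrite (_ : _ @^-1` _ = [set p | G (f p) (g p)])//.
by apply/seteqP; split => p /=; case: (g p).
Qed.

(* [y] codes a tangent vector (its entry 0) and a sequence in [G x] realizing it
   along the steps [1 / (i + 1)], with all bounds controlled by [C]. *)
Definition tangent_code u z (C : nat) : set (T * seqs nat) := [set p |
  [/\ forall i, G p.1 (hprod_code R m k p.2 i.+1),
      forall i, `|i.+1%:R *: (hprod_code R m k p.2 i.+1 - pair_fun u p.1) -
                 hprod_code R m k p.2 0| <= C%:R,
      `|i.+1%:R *: (hprod_code R m k p.2 i.+1 - pair_fun u p.1) -
                 hprod_code R m k p.2 0| @[i --> \oo] --> (0 : R),
      `|hprod_code R m k p.2 0| <= C%:R &
      0 < inner (pair_fun z p.1) (hprod_code R m k p.2 0)]].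

Lemma measurable_tangent_code u z C : measurable (tangent_code u z C).
Proof.
have mW i : measurable_hprod (fun p : T * seqs nat => hprod_code R m k p.2 i).
  exact: (measurable_hprod_comp (measurable_hprod_code R m k i) measurable_snd).
have mp v : measurable_hprod (fun p : T * seqs nat => pair_fun v p.1).
  exact: (measurable_hprod_comp (measurable_pair_fun v) measurable_fst).
pose b i (p : T * seqs nat) : R :=
  `|i.+1%:R *: (hprod_code R m k p.2 i.+1 - pair_fun u p.1)
    - hprod_code R m k p.2 0|.
have mb i : measurable_fun setT (b i).
  by apply/measurable_hprod_norm/measurable_hprodB => //;
    apply/measurable_hprodZ/measurable_hprodB.
rewrite (_ : tangent_code u z C =
   (\bigcap_i [set p | G p.1 (hprod_code R m k p.2 i.+1)]) `&`
   (\bigcap_i [set p | b i p <= C%:R]) `&`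
   [set p | b i p @[i --> \oo] --> 0] `&`
   [set p | `|hprod_code R m k p.2 0| <= C%:R] `&`
   ~` [set p | inner (pair_fun z p.1) (hprod_code R m k p.2 0) <= 0]);
     last first.
  apply/seteqP; split => p /=.
    move=> [h1 h2 h3 h4 h5]; do ![split => //]; first by move=> i _; exact: h1.
    by move=> i _; exact: h2.
    by apply/negP; rewrite -ltNge.
  move=> [[[[h1 h2] h3] h4] /negP]; rewrite -ltNge => h5; split => // i.
    exact: h1.
  exact: h2.
apply: measurableI; [apply: measurableI; [apply: measurableI;
  [apply: measurableI|]|]|].
- by apply: bigcapT_measurable => i; apply: measurable_mem_graph => //;
    exact: measurable_fst.
- by apply: bigcapT_measurable => i; apply: measurable_fun_le_set => //;
    exact: measurable_cst.
- by apply: measurable_cvg0 => // i p; exact: normr_ge0.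
- by apply: measurable_fun_le_set;
    [exact: measurable_hprod_norm|exact: measurable_cst].
- apply: measurableC; apply: measurable_fun_le_set; last exact: measurable_cst.
  exact: measurable_hprod_inner.
Qed.

(** The selected vectors are used on [B] and extended by 0. The approximating points then equal the
    coded points of [G x] on [B] and [u] elsewhere, the quotients converge in L^2 by domination, and
    [inner z t] integrates a function positive exactly on [B]. *)
Lemma tangent_of_code u z (C : nat) (B : set T) (r : T -> seqs nat) :
  measurable B -> (0 < mu B < +oo)%E -> measurable_fun setT r ->
  (forall x, B x -> tangent_code u z C (x, r x)) ->
  (\forall x \ae mu, G x (pair_fun u x)) ->
  exists t : LL,
    tangent_cone [set v : LL | \forall x \ae mu, G x (pair_fun v x)] u t /\
    0 < inner z t.
Proof.
move=> mB /andP[B0 Boo] mr Br Gu.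
pose w i x : H := hprod_code R m k (r x) i.
have mw i : measurable_hprod (w i).
  exact: (measurable_hprod_comp (measurable_hprod_code R m k i) mr).
have m0 : measurable_hprod (fun=> 0 : H) by split; exact: measurable_cst.
pose dq i x : H := i.+1%:R *: (w i.+1 x - pair_fun u x).
have mdq i : measurable_hprod (dq i).
  by apply/measurable_hprodZ/measurable_hprodB => //;
    exact: measurable_pair_fun.
have [t tE] : exists t : LL, \forall x \ae mu,
    pair_fun t x = if x \in B then w 0%N x else 0.
  apply: pair_lift; first exact: measurable_hprod_if.
  by apply: (bounded_on_square_integrable (C := C%:R)) => // x /Br[].
have /choice[h hE] : forall i, exists h : LL, \forall x \ae mu,
    pair_fun h x = if x \in B then dq i x else 0.
  move=> i; apply: pair_lift; first exact: measurable_hprod_if.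
  (* The quotient is at distance at most [C] from a vector of norm at most [C]. *)
  apply: (bounded_on_square_integrable (C := C%:R + C%:R)) =>
    // x /Br[/= _ /(_ i) dC _ wC _].
  rewrite -(subrK (w 0%N x) (dq i x)); apply: (le_trans (ler_normD _ _)).
  exact: lerD.
pose dt i x : H := if x \in B then dq i x - w 0%N x else 0.
have htE : \forall x \ae mu, forall i, pair_fun (h i - t) x = dt i x.
  apply: ae_foralln => i; apply: filterS2 (pair_funB (h i) t) (filterI (hE i)
    tE).
  move=> x -> [-> ->]; rewrite /dt; case: ifP => // _; exact: subr0.
have dt0 x : `|dt i x| @[i --> \oo] --> (0 : R).
  rewrite /dt; case: (boolP (x \in B)) => [/set_mem Bx|_];
    first by have [] := Br _ Bx.
  by rewrite normr0; exact: cvg_cst.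
exists t; split.
  exists (fun i => i.+1%:R^-1), (fun i => u + i.+1%:R^-1 *: h i); split => //.
  - exact: cvg_harmonic.
  - move=> i /=; near=> x.
    have -> : pair_fun (u + i.+1%:R^-1 *: h i) x =
        pair_fun u x + i.+1%:R^-1 *: pair_fun (h i) x.
      by rewrite (near (pair_funD u (i.+1%:R^-1 *: h i))
        x)// (near (pair_funZ i.+1%:R^-1 (h i)) x).
    rewrite (near (hE i) x)//; case: ifPn => [/set_mem Bx|_].
      rewrite scalerA mulVf ?scale1r// addrC subrK.
      by have [/= Gw _ _ _ _] := Br _ Bx; exact: Gw.
    by rewrite scaler0 addr0; near: x.
  - rewrite (_ : (fun i => _) = h); last first.
      by apply/funext => i; rewrite invrK addrC addKr scalerA mulfV ?scale1r.
    (* The squared errors are dominated by [C ^+ 2] times the indicator of [B], integrable because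
       [B] has finite measure. *)
    have D0 : (\int[mu]_x (`|pair_fun (h i - t) x| ^+ 2)%:E)%E @[i --> \oo]
      --> 0%E.
      have [|||||_ _] := @dominated_convergence _ _ R mu setT measurableT
        (fun i x => (`|pair_fun (h i - t) x| ^+ 2)%:E) (cst 0%E)
        (fun x => (C%:R ^+ 2 * \1_B x)%:E).
      - by move=> i; apply/measurable_EFinP/measurable_funX/measurable_hprod_norm/measurable_pair_fun.
      - exact: measurable_cst.
      - apply: filterS htE => x hx _; rewrite (_ : cst _ _ = (0 ^+ 2)%:E);
          last by rewrite expr0n.
        apply: cvg_EFin; first exact: nearW.
        rewrite [X in X @ _](_ : _ = (fun i => `|dt i x| * `|dt i x|));
          last first.
          by apply/funext => i; rewrite /= hx expr2.
        by rewrite expr2; apply: cvgM; exact: dt0.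
      - apply/integrableP; split.
          by apply/measurable_EFinP; apply: measurable_funM;
            [exact: measurable_cst|exact: measurable_indic].
        under eq_integral do rewrite gee0_abs ?lee_fin ?mulr_ge0 ?sqr_ge0//
          EFinM.
        rewrite ge0_integralZl//; last by apply/measurable_EFinP;
          exact: measurable_indic.
        by rewrite integral_indic// setIT lte_mul_pinfty// lee_fin sqr_ge0.
      - apply: filterS htE => x hx i _.
        rewrite hx gee0_abs ?lee_fin ?sqr_ge0// /dt indicE.
        case: ifPn => [/set_mem Bx|_]; last by rewrite normr0 expr0n mulr0.
        by rewrite mulr1 ler_pXn2r ?nnegrE//; have [/= _ + _ _ _] := Br _ Bx;
          exact.
      - by rewrite /= integral0.
    apply/cvgrPdist_lt => e e0.
    have /fine_cvgP[_ /cvgr0Pnorm_lt/(_ _ (exprn_gt0 2 e0))] := D0.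
    apply: filterS => i /=; rewrite -pair_normE /= ger0_norm ?sqr_ge0//.
    by rewrite ltr_pXn2r ?nnegrE ?(ltW e0)// distrC.
pose phi x : R := if x \in B then inner (pair_fun z x) (w 0%N x) else 0.
have mphi : measurable_fun setT phi.
  apply: measurable_fun_ifT; last exact: measurable_cst.
    apply: (measurable_fun_bool true).
    rewrite setTI (_ : _ @^-1` _ = B)//; apply/seteqP.
    by split => x /=; [exact: set_mem|exact: mem_set].
  by apply: measurable_hprod_inner => //; exact: measurable_pair_fun.
have phi0 x : 0 <= phi x.
  by rewrite /phi; case: ifPn => // /set_mem/Br[_ _ _ _ /ltW].
have phiE : (\int[mu]_x (phi x)%:E)%E = (inner z t)%:E.
  rewrite pair_innerE fineK; last exact: integrable_fin_num
    (integrable_pair_inner z t).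
  apply: ae_eq_integral => //.
  - exact/measurable_EFinP.
  - by apply/measurable_EFinP/measurable_hprod_inner;
      exact: measurable_pair_fun.
  - apply: filterS tE => x tx _; rewrite tx /phi.
    by case: ifP => // _; rewrite innerC inner0l.
(* Otherwise [phi], being nonnegative with integral at most 0, vanishes almost everywhere, although
   it is positive on [B]. *)
rewrite ltNge; apply/negP => zt.
have : (\int[mu]_x `|(phi x)%:E| = 0)%E.
  under eq_integral do rewrite gee0_abs ?lee_fin//.
  apply/eqP; rewrite eq_le phiE lee_fin zt /= -phiE.
  by apply: integral_ge0 => x _; rewrite lee_fin.
move=> /(ae_eq_integral_abs mu measurableT (f := EFin \o phi) _).1.
case; first exact/measurable_EFinP.
move=> N [mN N0 BN]; move: B0; rewrite lt0e => /andP[/eqP + _]; apply.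
apply/eqP; rewrite -measure_le0 -N0; apply: le_measure; rewrite ?inE//.
move=> x Bx; apply: BN => /(_ I) /= [] /eqP; rewrite /phi mem_set//.
by apply/negP; rewrite gt_eqF//; have [] := Br _ Bx.
Unshelve. all: by end_near. Qed.

(** A failure of pointwise polarity is localized to a set of finite measure with a uniform bound
    [C], where codes can be selected measurably; the L^2 tangent vector they produce contradicts
    [zT]. *)
Lemma polar_pointwise u z :
  (\forall x \ae mu, geometrically_derivable (G x)) ->
  (\forall x \ae mu, G x (pair_fun u x)) ->
  (forall t, tangent_cone [set v : LL | \forall x \ae mu,
    G x (pair_fun v x)] u t ->
    inner z t <= 0) ->
  \forall x \ae mu, forall t, tangent_cone (G x) (pair_fun u x) t ->
    inner (pair_fun z x) t <= 0.
Proof.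
move=> gG Gu zT; apply: contrapT => nz.
(* These sets exhaust the points where [z] is nonzero and have finite measure by Chebyshev's
   inequality, even if [mu] is infinite. *)
pose F (C : nat) := [set x | C.+1%:R^-1 <= `|pair_fun z x| ^+ 2].
have mn : measurable_fun setT (fun x => `|pair_fun z x| ^+ 2 : R).
  exact/measurable_funX/measurable_hprod_norm/measurable_pair_fun.
have mF C : measurable (F C) by apply: measurable_fun_le_set => //;
  exact: measurable_cst.
have Foo C : (mu (F C) < +oo)%E.
  have c0 : 0 < C.+1%:R^-1 :> R by rewrite invr_gt0.
  have : (C.+1%:R^-1%:E * mu (F C) < +oo)%E.
    rewrite -[F C]setIT -integral_indic// -ge0_integralZl//; last first.
    - by apply/measurable_EFinP; exact: measurable_indic.
    apply: (@le_lt_trans _ _ (`|z| ^+ 2)%:E); last exact: ltry.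
    rewrite pair_normE; apply: ge0_le_integral => //.
    - apply/measurable_EFinP; apply: measurable_funM;
        first exact: measurable_cst.
      exact: measurable_indic.
    - exact/measurable_EFinP.
    - move=> x _; rewrite -EFinM lee_fin indicE;
        case: (boolP (x \in F C)) => [/set_mem|_].
        by rewrite mulr1.
      by rewrite mulr0 sqr_ge0.
  by case: (mu (F C)) (measure_ge0 mu (F C)) => [s||]// _;
    rewrite ?ltry// gt0_muley ?lte_fin.
(* A countable union of negligible sets is negligible, so a single [C] already carries a
   non-negligible part of the failure. *)
have [C FC] : exists C, ~ mu.-negligible
    [set x | F C x /\ exists y, tangent_code u z C (x, y)].
  apply: contrapT => nC; apply: nz.
  have nC' C : mu.-negligible [set x | F C x /\ exists y,
    tangent_code u z C (x, y)].
    by apply: contrapT => h; apply: nC; exists C.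
  have cC := negligible_bigcup nC'.
  have {}cC : \forall x \ae mu, ~ (exists C, F C x /\ exists y,
    tangent_code u z C (x, y)).
    by apply: negligibleS cC => x /= /contrapT[C xC]; exists C.
  apply: filterS2 cC (filterI gG Gu) => x nx [gx ux] t tt.
  rewrite leNgt; apply/negP => zt; apply: nx.
  have [v Gv vt] := geometrically_derivable_seq gx ux tt.
  have [y yE] := hprod_code_surj (fun i => if i is i'.+1 then v i' else t).
  pose b i := `|i.+1%:R *: (v i - pair_fun u x) - t|.
  have b0 : b i @[i --> \oo] --> (0 : R).
    rewrite -(normr0 H) -(subrr t); apply: cvg_norm.
    by apply: cvgB; [exact: vt|exact: cvg_cst].
  have [C bC] : exists C : nat, forall i, b i <= C%:R.
    have /cvg_seq_bounded[M [_ /(_ (M + 1))]] := cvgP _ b0.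
    rewrite ltrDl => /(_ ltr01) bM; exists (Num.bound `|M + 1|) => i.
    apply: (le_trans (ler_norm _)); apply: (le_trans (bM i I)).
    exact/(le_trans (ler_norm _))/ltW/archi_boundP/normr_ge0.
  have zx0 : 0 < `|pair_fun z x| ^+ 2.
    rewrite exprn_gt0// normr_gt0; apply/eqP => zx; move: zt.
    by rewrite zx inner0l ltxx.
  have [C1 _ /(_ C1 (leqnn _)) /= C1z] := near_infty_natSinv_lt (PosNum zx0).
  have [C2 tC2] : exists C2 : nat, `|t| <= C2%:R.
    by exists (Num.bound `|t|); rewrite ltW// archi_boundP.
  (* All the requirements weaken as the index grows, so the sum meets the bounds on the quotients,
     on [z x] and on [t] at once. *)
  exists (C + C1 + C2)%N; split.
    rewrite /F /=; apply: le_trans (ltW C1z).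
    by rewrite lef_pV2 ?posrE// ler_nat ltnS -addnA addnCA leq_addr.
  exists y; split; rewrite /= yE//.
  - move=> i; apply: (le_trans (bC i)); by rewrite ler_nat -addnA leq_addr.
  - by apply: (le_trans tC2); rewrite ler_nat leq_addl.
have [B [r [mB BF B0 mr Br]]] := measurable_selection (mF C) (Foo C)
  (measurable_tangent_code u z C) FC.
have Boo : (mu B < +oo)%E.
  by apply: le_lt_trans (Foo C); apply: le_measure; rewrite ?inE.
have [|t [/zT zt0]] := tangent_of_code mB _ mr Br Gu; first by rewrite B0.
by rewrite ltNge zt0.
Qed.

End tangent_selection.

(** The converse passes from L^2 to the fibres: L^2 polarity gives pointwise polarity, which is
    regular normality in finite dimension, and this integrates back to L^2. *)
Lemma regular_normal_pointwiseP d (T : measurableType d) (R : realType)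
    (mu : {measure set T -> \bar R}) (m k : nat)
    (G : T -> set (hprod (euclid R m) (euclid R k)))
    (u z : hprod (L2 mu m) (L2 mu k)) :
  measurable ([set t | G t.1 t.2] : set (T * (euclid R m * euclid R k))) ->
  (\forall x \ae mu, geometrically_derivable (G x)) ->
  (\forall x \ae mu, G x (pair_fun u x)) ->
  let U := [set v : hprod (L2 mu m) (L2 mu k) | \forall x \ae mu,
    G x (pair_fun v x)] in
  regular_normal_cone U u z <-> forall t, tangent_cone U u t -> inner z t <= 0.
Proof.
move=> mG gG Gu U; split=> [zN t|zT]; first exact: regular_normal_cone_polar.
apply: pointwise_regular_normal.
apply: filterS (polar_pointwise mG gG Gu zT) => x.
exact/polar_regular_normal_cone/hprod_euclid_unit_ball_compact.
Qed.

(** * Coderivatives and upper adjoints *)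

Lemma upper_adjoint_convexified (R : realType) (Q W : innerProductType R)
    (F : Q -> set W) (q : Q) (w : W) :
  upper_adjoint (graphical_derivative F q w) =
  upper_adjoint (convexified_derivative F q w).
Proof.
apply/funext => dw; apply/seteqP; split => dq /= dqP a b ab; last first.
  by apply: dqP; exact: sub_gen_smallest.
(* The inequality defining the adjoint is linear in the pair, so it cuts out a convex half-space;
   containing the graph, it contains its convex hull. *)
pose half : set (hprod Q W) := [set y | inner dq y.1 <= inner dw y.2].
suff : half (a, b) by [].
apply: ab; split; last by move=> -[x y]; exact: dqP.
move=> x y l.
rewrite !inE /half /= => hx hy.
rewrite -[X in X <= _]/(inner dq (l%:num *: x.1 + (1 - l%:num) *: y.1)).
rewrite -[X in _ <= X]/(inner dw (l%:num *: x.2 + (1 - l%:num) *: y.2)).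
by rewrite !innerDr !innerZr lerD// ler_wpM2l// subr_ge0.
Qed.

Theorem theorem2p9 (R : realType) (n m k : nat)
    (Omega : set (euclid R n)) (oOmega : open Omega)
    (p : euclid R n -> euclid R m -> set (euclid R k))
    (q : L2 (lebesgue_on oOmega) m) (w : L2 (lebesgue_on oOmega) k) :
  let P := pointwise_map (lebesgue_on oOmega) p in
  borel_measurable_map Omega p ->
  {ae lebesgue_on oOmega, forall x, proto_differentiable (p x)} ->
  {ae lebesgue_on oOmega, forall x, locally_closed_graph (p x) (q x) (w x)} ->
  graph P (q, w) ->
  regular_coderivative P q w = upper_adjoint (graphical_derivative P q w) /\
  upper_adjoint (graphical_derivative P q w) =
    upper_adjoint (convexified_derivative P q w).
Proof.
move=> P mp pd _ Pqw; split; last exact: upper_adjoint_convexified.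
set mu := lebesgue_on oOmega in q w P pd Pqw *.
(* Measurability of the graph of [p] is given over [Omega] only, so membership in [Omega] is built
   into [G]; almost everywhere this changes nothing. *)
pose G x : set (hprod (euclid R m) (euclid R k)) :=
  [set y | Omega x /\ graph (p x) y].
have mG : measurable ([set t | G t.1 t.2] :
    set (euclid R n * (euclid R m * euclid R k))).
  (* [a] only reassociates the triple to match the product in [borel_measurable_map]. *)
  pose a (t : euclid R n * (euclid R m * euclid R k)) := ((t.1, t.2.1), t.2.2).
  have ma : measurable_fun setT a.
    apply: measurable_fun_pair; [apply: measurable_fun_pair => //|].
      exact: measurableT_comp.
    exact: measurableT_comp.
  have := ma measurableT _ (borel_prod3 mp); rewrite setTI.
  exact.
have aeO : \forall x \ae mu, Omega x.
  exists (~` Omega); split => //;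
    first exact: (measurableC (open_measurable_euclid oOmega)).
  by rewrite [LHS](_ : _ = lebesgue_euclid R n (~` Omega `&` Omega))// setICl
    measure0.
have gG : \forall x \ae mu, geometrically_derivable (G x).
  apply: filterS2 aeO pd => x Ox; rewrite (_ : G x = graph (p x))//.
  by apply/seteqP; split => [y []|y].
have UE : graph P = [set v | \forall x \ae mu, G x (pair_fun v x)].
  apply/seteqP; split => v; first by move=> Pv; apply: filterS2 aeO Pv => x.
  by apply: filterS => x [].
have Gu : \forall x \ae mu, G x (pair_fun (q, w) x).
  by move: Pqw; rewrite UE.
apply/funext => dw; apply/seteqP; split => dq.
  rewrite /regular_coderivative /= UE =>
    /(regular_normal_pointwiseP _ mG gG Gu) zT a b.
  rewrite /graphical_derivative /= UE => /zT.
  (* The coderivative carries [- dw] in the second slot, so polarity of the pair is exactly the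
     adjoint inequality. *)
  by rewrite [inner _ _]/(_ + _) /= innerNl subr_le0.
move=> dqP; rewrite /regular_coderivative /= UE.
apply/(regular_normal_pointwiseP _ mG gG Gu) => -[a b]; rewrite -UE => ab.
rewrite [inner _ _]/(_ + _) /= innerNl subr_le0; exact: dqP.
Qed.
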